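(* Let $q$ be an odd prime power, let $n\ge 4$ be an integer which is very divisible relative to $q$, and let $g=\gcd(n,q-1)$. If $g=1$, then the maximal subgroup $P$ gives the minimal faithful permutation representation of $\mathrm{SL}_n(\mathbb{F}_q)$, and $$p(\mathrm{SL}_n(\mathbb{F}_q))=\frac{|\mathrm{SL}_n(\mathbb{F}_q)|}{|P|}=\frac{q^n-1}{q-1}.$$ If $g>1$, write $g=p_1^{r_1}\cdots p_s^{r_s}$ with $p_1,\dots,p_s$ distinct primes and all $r_j\ge1$, and let $p_j^{a_j}$ be the highest power of $p_j$ dividing $q-1$. For each $j$ let $H_j$ be the biggest (i.e. of largest order) subgroup of $P$ having trivial intersection with the subgroup of order $p_j$ of the center of $\mathrm{SL}_n(\mathbb{F}_q)$. Then $\{H_1,\dots,H_s\}$ gives the minimal faithful permutation representation of $\mathrm{SL}_n(\mathbb{F}_q)$, and $$p(\mathrm{SL}_n(\mathbb{F}_q))=\frac{q^n-1}{q-1}\cdot\left(p_1^{a_1}+\cdots+p_s^{a_s}\right).$$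
   Context: For a finite group $G$, $p(G)$ is the smallest natural number $m$ such that the symmetric group $S_m$ has a subgroup isomorphic to $G$. A finite collection $\{H_1,\dots,H_\ell\}$ of subgroups of $G$ is faithful if $\mathrm{core}_G(H_1\cap\dots\cap H_\ell)=\{e\}$, where $\mathrm{core}_G(H)=\bigcap_{x\in G}xHx^{-1}$; it is minimal faithful (gives the minimal faithful permutation representation) if in addition $\sum_i[G:H_i]$ is minimal among all faithful collections, in which case $\sum_i [G:H_i]=p(G)$. $P$ is the subgroup of $\mathrm{SL}_n(\mathbb{F}_q)$ of all matrices $\begin{pmatrix} B & x\\ 0& b\end{pmatrix}$ with $B\in\mathrm{GL}_{n-1}(\mathbb{F}_q)$, $x\in\mathbb{F}_q^{n-1}$ and $b^{-1}=\det B$. Very divisible: with $g=\gcd(n,q-1)=p_1^{r_1}\cdots p_s^{r_s}$ (distinct primes, $r_j\ge 1$) and $p_j^{a_j}$ the highest power of $p_j$ dividing $q-1$, the integer $n$ is very divisible relative to $q$ if $p_j^{a_j}$ divides $n$ for all $1\le j\le s$. *)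

(* Defs.v *)
From HB Require Import structures.
From mathcomp Require Import all_boot all_order all_algebra all_fingroup.
Set Implicit Arguments.
Unset Strict Implicit.
Unset Printing Implicit Defensive.
Import GroupScope GRing.Theory.

Section PermutationDegree.
Variable gT : finGroupType.
Implicit Type G : {group gT}.

Definition embeds_in_Sym G (m : nat) : bool :=
  [exists H : {group 'S_m}, G \isog H].

Fact cayley_inj (x : gT) :
  injective (fun i : 'I_#|gT| => enum_rank (enum_val i * x)).
Proof. by move=> i j /enum_rank_inj/mulIg/enum_val_inj. Qed.

Definition cayley (x : gT) : 'S_#|gT| := perm (@cayley_inj x).

Fact cayleyM G : {in G &, {morph cayley : x y / x * y}}.
Proof.
by move=> x y _ _; apply/permP=> i; rewrite permM !permE enum_rankK mulgA.
Qed.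

Canonical cayley_morphism G := Morphism (@cayleyM G).

Fact embeds_in_Sym_ex G : exists m, embeds_in_Sym G m.
Proof.
exists #|gT|; apply/existsP; exists (cayley_morphism G @* G)%G.
apply: (sub_isog (f := cayley_morphism G)) => //.
apply/injmP=> x y _ _ /permP/(_ (enum_rank 1)).
by rewrite !permE enum_rankK !mul1g => /enum_rank_inj.
Qed.

Definition perm_degree G : nat := ex_minn (embeds_in_Sym_ex G).

(* The outer [G :&: _] only matters for the empty collection, whose
   intersection is thus read as G rather than the whole ambient group. *)
Definition faithful_collection G (s : seq {group gT}) : bool :=
  all (fun H : {group gT} => H \subset G) s
  && (gcore (G :&: \bigcap_(H <- s) (H : {set gT})) G == 1).

Definition collection_degree G (s : seq {group gT}) : nat :=
  \sum_(H <- s) #|G : H|.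

Definition minimal_faithful G (s : seq {group gT}) : Prop :=
  faithful_collection G s /\
  forall t, faithful_collection G t ->
    (collection_degree G s <= collection_degree G t)%N.

Definition biggest_avoiding (A Z K : {group gT}) : Prop :=
  [/\ K \subset A, K :&: Z = 1
    & forall L : {group gT}, L \subset A -> L :&: Z = 1 -> (#|L| <= #|K|)%N].

End PermutationDegree.

Section SpecialLinear.
Variables (n : nat) (F : finFieldType).

Definition SL : {set {'GL_n[F]}} := [set A : {'GL_n[F]} | (\det A == 1)%R].

Fact SL_group_set : group_set SL.
Proof.
apply/group_setP; split=> [|A B]; first by rewrite inE GL_1E det1.
by rewrite !inE GL_MxE det_mulmx => /eqP-> /eqP->; rewrite mulr1.
Qed.

Canonical SL_group := Group SL_group_set.

(* [addn1 n.-1] casts the block decomposition (n - 1) + 1 to the size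
   n.-1.+1 of the matrices underlying {'GL_n[F]}. *)
Definition parabolic_block (B : 'M[F]_n.-1) (x : 'cV[F]_n.-1) (b : F) :
    'M[F]_n.-1.+1 :=
  castmx (addn1 n.-1, addn1 n.-1) (block_mx B x 0%R b%:M%R).

Definition parabolic : {set {'GL_n[F]}} :=
  [set A : {'GL_n[F]} |
    [exists B : 'M[F]_n.-1, exists x : 'cV[F]_n.-1, exists b : F,
      [&& B \in unitmx, (b^-1 == \det B)%R
        & GLval A == parabolic_block B x b]]].

Fact parabolicP (A : {'GL_n[F]}) :
  reflect (exists B x b, [/\ B \in unitmx, b^-1 = \det B
                           & GLval A = parabolic_block B x b])%R
          (A \in parabolic).
Proof.
rewrite inE; apply: (iffP existsP) => [[B]|[B [x [b [uB bB AE]]]]].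
  case/existsP=> x /existsP[b /and3P[uB /eqP bB /eqP AE]].
  by exists B, x, b.
by exists B; apply/existsP; exists x; apply/existsP; exists b; rewrite uB bB AE !eqxx.
Qed.

Fact parabolic_blockM B x b C y c :
  (parabolic_block B x b *m parabolic_block C y c =
   parabolic_block (B *m C) (B *m y + c *: x) (b * c))%R.
Proof.
rewrite /parabolic_block; move: (addn1 n.-1); case: _ / => /=.
rewrite !castmx_id mulmx_block !mulmx0 !mul0mx !addr0 !add0r -scalar_mxM.
by rewrite mul_mx_scalar.
Qed.

Fact parabolic_block1 : (parabolic_block 1%:M 0 1 = 1%:M)%R.
Proof.
rewrite /parabolic_block; move: (addn1 n.-1); case: _ / => /=.
by rewrite castmx_id -scalar_mx_block.
Qed.

Fact det_parabolic_block B x b : (\det (parabolic_block B x b) = \det B * b)%R.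
Proof.
rewrite /parabolic_block; move: (addn1 n.-1); case: _ / => /=.
by rewrite castmx_id det_ublock det_scalar1.
Qed.

Fact parabolic_group_set : group_set parabolic.
Proof.
apply/group_setP; split=> [|A A'].
  apply/parabolicP; exists 1%:M%R, 0%R, 1%R.
  by rewrite unitmx1 det1 invr1 parabolic_block1 GL_1E.
case/parabolicP=> B [x [b [uB bB AE]]] /parabolicP[C [y [c [uC cC A'E]]]].
apply/parabolicP; exists (B *m C)%R, (B *m y + c *: x)%R, (b * c)%R.
rewrite unitmx_mul uB uC det_mulmx -bB -cC invfM GL_MxE AE A'E.
by rewrite parabolic_blockM.
Qed.

Canonical parabolic_group := Group parabolic_group_set.

Fact parabolic_sub_SL : parabolic \subset SL.
Proof.
apply/subsetP=> A /parabolicP[B [x [b [uB bB AE]]]].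
rewrite inE AE det_parabolic_block -bB mulVf //.
by rewrite -invr_eq0 bB -unitfE -unitmxE.
Qed.

End SpecialLinear.

Local Open Scope nat_scope.

Definition very_divisible (n q : nat) : Prop :=
  forall p, p \in primes (gcdn n (q - 1)) -> p ^ logn p (q - 1) %| n.

(* Main.v *)
Require Import Defs.
From mathcomp Require Import all_boot all_order all_algebra all_fingroup all_solvable.
From mathcomp Require Import zify.
Set Implicit Arguments.
Unset Strict Implicit.
Unset Printing Implicit Defensive.
Import GroupScope GRing.Theory.

(* The heart of the matter is that SL_n(q), n >= 4 and q odd, acts nontrivially
   and transitively only on sets S with at least d = (q^n - 1)/(q - 1) points.
   Suppose 1 < #|S| < d, and let Q be the group, of order N = q^(n-1), of the
   transvections with a given axis. The nontrivial elements of Q are conjugate, so by Burnside's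
   lemma each of them moves a multiple of N points, hence exactly N. Counting orbits
   again for a point stabiliser R in Q, R is transitive on the other orbits of Q; the
   action of the transvections normalising Q then forces R to be trivial, or Q, or of
   index at most q. The same holds for the transvections with a given center.
   - If #|S| < d - 1, then some orbit of Q is regular, so all elements of Q^# have
     the same fixed points, and the same is true of all transvections. They have
     thus no fixed point, #|S| = N, and a point stabiliser contains a lift of every
     element of SL_(n-1)(q) to the parabolic normalising Q; commuting lifts of
     transvections show (for q odd) that some lift is a transvection.
   - If #|S| = d - 1, then this parabolic, of index d, is transitive on S, so no R is
     trivial, and all of them have index q. A commutator of two transvections of a
     point stabiliser yields a contradiction.

   If a subgroup H avoids the p-parts of the scalars for p in a nonempty set J, and
   Z is the J-part of the scalars, of order prod_(p in J) p^a_p by very divisibility,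
   then H Z is a proper subgroup since SL_n(q) is perfect, so H has index at least
   d #|Z|, and #|Z| is at least the sum of the p^a_p. *)

(** * Actions with constant fixity *)

Section ConstantFixity.
Variables (gT : finGroupType) (T : finType) (to : {action gT &-> T}).
Variables (S : {set T}) (Q : {group gT}) (f : nat).
Hypothesis actsQ : [acts Q, on S | to].
Hypothesis fixQ : {in Q^#, forall u, #|'Fix_(S | to)[u]| = f}.

(** Burnside's count: the identity fixes [#|S|] points and each of the other [#|R| - 1] elements
    fixes [f]. *)
Lemma card_orbits_constant_fixity (R : {group gT}) : R \subset Q ->
  (#|orbit to R @: S| * #|R| = #|S| + (#|R| - 1) * f)%N.
Proof.
move=> sRQ; rewrite -Frobenius_Cauchy; last exact: subset_trans sRQ actsQ.
rewrite (bigD1 1) //=; congr addn.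
  by apply: eq_card => x; rewrite inE; case: (x \in S) => //=; apply/afix1P; rewrite act1.
rewrite (eq_bigr (fun=> f)) => [|u /andP[Ru u1]]; last first.
  by rewrite fixQ // !inE u1 (subsetP sRQ).
rewrite sum_nat_const (cardsD1 1 R) group1 add1n subn1 /=.
by congr (_ * _)%N; apply: eq_card => u; rewrite !inE andbC.
Qed.

Lemma constant_fixity_moved_dvd : (f < #|S|)%N -> (#|Q| %| #|S| - f)%N.
Proof.
move=> fS; have := card_orbits_constant_fixity (subxx Q).
set k := #|_ @: _| => kE.
have Q0 := cardG_gt0 Q.
have E : (#|S| - f + #|Q| * f = k * #|Q|)%N by rewrite kE; nia.
have : (#|Q| %| #|S| - f + #|Q| * f)%N by rewrite E dvdn_mull.
by rewrite dvdn_addl // dvdn_mulr.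
Qed.

Hypothesis cardS : #|S| = (f + #|Q|)%N.

Lemma card_orbits_moved1 : #|orbit to Q @: S| = f.+1.
Proof.
have := card_orbits_constant_fixity (subxx Q); have := cardG_gt0 Q.
by rewrite cardS => Q0 kE; apply/eqP; rewrite -(eqn_pmul2r Q0) kE; apply/eqP; nia.
Qed.

Hypothesis abQ : abelian Q.

(* Q has f + 1 orbits on S and R := C_Q[s] has f + #|Q : R|; as R fixes the
   #|Q : R| points of the orbit of s, no other orbit of Q splits under R. *)
Lemma orbit_stab_other_orbit s s' : s \in S -> s' \in S ->
  s' \notin orbit to Q s -> orbit to 'C_Q[s | to] s' = orbit to Q s'.
Proof.
move=> Ss Ss' s'Q; pose R := ('C_Q[s | to])%G.
have sRQ : R \subset Q by apply: subsetIl.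
have partQ := orbit_partition actsQ.
have subO O : O \in orbit to Q @: S -> [acts R, on O | to].
  by case/imsetP=> x Sx ->; apply: (subset_trans sRQ); apply: acts_orbit; apply: subsetT.
pose c (O : {set T}) := #|orbit to R @: O|.
have c_gt0 O : O \in orbit to Q @: S -> (0 < c O)%N.
  case/imsetP=> x Sx ->; rewrite card_gt0; apply/set0Pn.
  by exists (orbit to R x); apply: imset_f; apply: orbit_refl.
have cE O : O \in orbit to Q @: S ->
    \sum_(u in R) #|'Fix_(O | to)[u]| = (c O * #|R|)%N.
  by move=> PO; apply: Frobenius_Cauchy; apply: subO.
(* Burnside's lemma for [R] on each [Q]-orbit, summed, is Burnside's lemma for [R] on [S]:
   altogether [R] has [f + #|Q : R|] orbits. *)
have sumc : (\sum_(O in orbit to Q @: S) c O * #|R| = #|Q| + #|R| * f)%N.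
  rewrite -(eq_bigr _ cE) exchange_big /=.
  transitivity (\sum_(u in R) #|'Fix_(S | to)[u]|).
    apply: eq_bigr => u Ru; rewrite -sum1_card.
    rewrite (eq_bigl (fun x => (x \in S) && (x \in 'Fix_to[u]))); last first.
      by move=> x; rewrite inE.
    rewrite (set_partition_big_cond _ partQ) /=.
    by apply: eq_bigr => O _; rewrite -sum1_card; apply: eq_bigl => x; rewrite inE.
  rewrite Frobenius_Cauchy; last exact: subset_trans sRQ actsQ.
  rewrite card_orbits_constant_fixity // cardS.
  have := cardG_gt0 R; move: #|_| (#|Q|) => r N r0; rewrite mulnBl mul1n.
  have : (f <= r * f)%N by apply: leq_pmull.
  lia.
have POs : orbit to Q s \in orbit to Q @: S by apply: imset_f.
have POs' : orbit to Q s' \in orbit to Q @: S by apply: imset_f.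
have cOs : (c (orbit to Q s) * #|R|)%N = #|Q|.
  rewrite -cE // (eq_bigr (fun=> #|orbit to Q s|)) => [|u Ru]; last first.
    congr #|pred_of_set _|; apply/setIidPl/subsetP=> x /orbitP[v Qv <-].
    move: Ru; rewrite inE => /andP[Qu /astab1P su].
    by apply/afix1P; rewrite -actM (centsP abQ v _ u) // actM su.
  by rewrite sum_nat_const mulnC card_orbit_stab.
have neO : orbit to Q s' != orbit to Q s.
  by apply: contraNneq s'Q => <-; apply: orbit_refl.
(* The other [f] orbits of [Q] contain [f] orbits of [R] in all and at least one each, hence exactly
   one each. *)
have c1 : c (orbit to Q s') = 1%N.
  move: sumc; rewrite (bigD1 _ POs) /= cOs => /addnI.
  rewrite -big_distrl /= [RHS]mulnC => /eqP.
  rewrite eqn_pmul2r // => /eqP sumc'.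
  have : (\sum_(O in orbit to Q @: S | O != orbit to Q s) 1 = f)%N.
    by have := card_orbits_moved1; rewrite -sum1_card (bigD1 _ POs) /= add1n; case.
  rewrite -{}sumc' => /eqP; rewrite eq_sym eqn_leq => /andP[le1 _].
  move: le1; rewrite (bigD1 (orbit to Q s')) /=; last exact/andP.
  rewrite [X in (_ <= X)%N](bigD1 (orbit to Q s')) /=; last exact/andP.
  have := c_gt0 _ POs'; set A := \sum_(i | _) c i; set B := \sum_(i | _) 1.
  have : (B <= A)%N by apply: leq_sum => O /andP[/andP[PO _] _]; apply: c_gt0.
  lia.
apply/eqP; rewrite eqEsubset; apply/andP; split.
  apply/subsetP=> x /orbitP[u Ru <-]; apply: mem_orbit.
  exact: (subsetP sRQ).
apply/subsetP=> x Qx.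
have : orbit to R x \in orbit to R @: orbit to Q s' by apply: imset_f.
have : orbit to R s' \in orbit to R @: orbit to Q s'.
  by apply: imset_f; apply: orbit_refl.
move/eqP: c1; rewrite /c => /cards1P[B ->]; rewrite !inE => /eqP-> /eqP <-.
exact: orbit_refl.
Qed.
End ConstantFixity.

Lemma act_conj_fix (gT : finGroupType) (T : finType) (to : {action gT &-> T}) s u g :
  (to s (u ^ g)%g == s) = (to (to s g^-1%g) u == to s g^-1%g).
Proof. by rewrite -{1 2}[s](actKV to g) -actCJ (inj_eq (act_inj to g)). Qed.

Lemma eq_card_index (gT : finGroupType) (G X Y : {group gT}) :
  X \subset G -> Y \subset G -> #|X| = #|Y| -> #|G : X| = #|G : Y|.
Proof. by move=> sXG sYG cardXY; rewrite -!divgS // cardXY. Qed.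

(** The stabiliser of a point has index [#|S|], coprime to that of [X], so its product with [X] is
    [G]. *)
Lemma coprime_index_transitive (gT : finGroupType) (T : finType)
    (to : {action gT &-> T}) (G X : {group gT}) (S : {set T}) :
  [transitive G, on S | to] -> X \subset G -> coprime #|S| #|G : X| ->
  [transitive X, on S | to].
Proof.
move=> trG sXG coSX; have /imsetP[s Ss SE] := trG.
have cardS : #|G : 'C_G[s | to]| = #|S| by rewrite -card_orbit SE.
have GE : 'C_G[s | to] * X = G.
  by apply: coprime_index_mulG; rewrite ?subsetIl ?cardS.
apply/imsetP; exists s => //; apply/eqP; rewrite eqEsubset {2}SE [X in _ && X]imsetS //.
rewrite andbT; apply/subsetP=> t; rewrite SE => /orbitP[g Gg <-].
move: Gg; rewrite -GE => /mulsgP[h x /setIP[_ /astab1P hs] Xx ->].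
by rewrite actM hs mem_orbit.
Qed.

Lemma commg_of_mul (gT : finGroupType) (x y z : gT) :
  (x * y = z * (y * x))%g -> z = [~ x^-1, y^-1]%g.
Proof.
by move=> E; rewrite commgEl conjgE !invgK mulgA E !mulgA !mulgK.
Qed.

Lemma derived_sub_central_mul (gT : finGroupType) (H Z : {group gT}) :
  Z \subset 'C(H) -> abelian Z -> (H * Z)^`(1) \subset H.
Proof.
move=> cHZ abZ; rewrite -(cent_joinEr cHZ); apply: der1_min.
  by rewrite join_subG normG (subset_trans cHZ) ?cent_sub.
by rewrite /= cent_joinEr // quotientMidl quotient_abelian.
Qed.

(** * Minimal degree and faithful collections *)

Section PermutationDegree.
Variable gT : finGroupType.
Implicit Types (G : {group gT}) (t : seq {group gT}).

Fact perm_rank_inj (D : finType) (p : {perm D}) :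
  injective (fun i : 'I_#|D| => enum_rank (p (enum_val i))).
Proof. by move=> i j /enum_rank_inj/perm_inj/enum_val_inj. Qed.

Definition perm_rank (D : finType) (p : {perm D}) : 'S_#|D| := perm (@perm_rank_inj D p).

Lemma perm_rankM (D : finType) : {morph @perm_rank D : p r / p * r}.
Proof. by move=> p r; apply/permP=> i; rewrite permM !permE enum_rankK /=. Qed.

Lemma perm_rank_eq1 (D : finType) (p : {perm D}) : perm_rank p = 1 -> p = 1.
Proof.
move=> p1; apply/permP=> x; have /permP/(_ (enum_rank x)) := p1.
by rewrite !permE enum_rankK => /enum_rank_inj.
Qed.

Lemma embeds_in_Sym_action G (X : finType) (to : {action gT &-> X}) (S : {set X}) :
  [acts G, on S | to] -> 'C_G(S | to) = 1 -> embeds_in_Sym G #|S|.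
Proof.
move=> actsG faithG; pose D := {x : X | x \in S}.
have <- : #|{: D}| = #|S| by rewrite card_sig; apply: eq_card.
have sGD : G \subset subact_dom (mem S) to.
  suff -> : subact_dom (mem S) to = 'N(S | to) by [].
  by congr 'N(_ | to); apply/setP=> x; rewrite inE.
pose rho (g : gT) : 'S_#|{: D}| := perm_rank (actperm (to^?)%act g : {perm D}).
have rhoM : {in G &, {morph rho : g h / g * h}}.
  move=> g h Gg Gh; rewrite /rho -perm_rankM; congr perm_rank.
  by apply: actpermM; apply: (subsetP sGD).
pose f := Morphism rhoM.
apply/existsP; exists (f @* G)%G; apply: (sub_isog (f := f)) => //.
apply/subsetP=> g /morphpreP[Gg /set1P/perm_rank_eq1 g1].
rewrite -faithG inE Gg; apply/astabP=> x Sx.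
have /permP/(_ (Sub x Sx)) := g1; rewrite actpermE perm1 => /(congr1 val).
by rewrite val_subact (subsetP sGD) // SubK.
Qed.

(** An element lies in the core exactly when all its conjugates lie in every member. For empty [t]
    the condition on [x] is vacuous, so [G] has to be trivial, in agreement with the [G :&: _] of
    [faithful_collection]. *)
Lemma faithful_collectionP G t :
  reflect ({in t, forall K : {group gT}, K \subset G} /\
           {in G, forall x, {in t & G, forall (K : {group gT}) g, x ^ g \in K} -> x = 1})
          (faithful_collection G t).
Proof.
have coreP x : x \in G -> {in t & G, forall (K : {group gT}) g, x ^ g \in K} <->
    x \in gcore (G :&: \bigcap_(K <- t) (K : {set gT})) G.
  move=> Gx; split=> [xK | /bigcapP core_x K g tK Gg].
    apply/bigcapP=> g Gg; rewrite mem_conjg inE groupJ ?groupV //=.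
    rewrite big_tnth; apply/bigcapP=> i _; apply: xK; rewrite ?groupV //.
    exact: mem_tnth.
  have := core_x g^-1 (groupVr Gg); rewrite mem_conjg invgK inE => /andP[_].
  have [i ->] : exists i, K = tnth (in_tuple t) i by apply/tnthP.
  by rewrite big_tnth => /bigcapP; apply.
apply: (iffP andP) => [[/allP sub_t /eqP core1] | [sub_t core1]].
  by split=> // x Gx /(coreP x Gx); rewrite core1 => /set1P.
split; first exact/allP.
rewrite eqEsubset; apply/andP; split; apply/subsetP=> x.
  move=> core_x; have Gx : x \in G.
    by move: core_x => /bigcapP/(_ 1 (group1 G)); rewrite conjsg1 => /setIP[].
  by apply/set1P/core1 => //; apply/coreP.
by move/set1P->; apply/coreP=> // K g tK Gg; rewrite conj1g.
Qed.

(** [G] acts by right translation on the disjoint union of the coset spaces. Cosets are tagged by a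
    position in [t], so that a repeated subgroup counts each time. *)
Lemma embeds_in_Sym_collection G t :
  faithful_collection G t -> embeds_in_Sym G (collection_degree G t).
Proof.
case/faithful_collectionP=> sub_t faith_t.
pose H (i : 'I_(size t)) := tnth (in_tuple t) i.
have sHG i : H i \subset G by apply/sub_t/mem_tnth.
pose toS (x : 'I_(size t) * {set gT}) g := (x.1, x.2 :* g).
have toS1 : toS^~ 1 =1 id by move=> [i C]; rewrite /toS /= mulg1.
have toSM x : act_morph toS x by move=> g h; rewrite /toS /= rcosetM.
pose to := TotalAction toS1 toSM.
pose S := [set x : 'I_(size t) * {set gT} | x.2 \in rcosets (H x.1) G].
have actsG : [acts G, on S | to].
  apply/subsetP=> g Gg; rewrite !inE /=; apply/subsetP=> -[i C]; rewrite !inE /=.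
  case/rcosetsP=> h Gh ->; rewrite -rcosetM; apply/rcosetsP.
  by exists (h * g); rewrite ?groupM.
have -> : collection_degree G t = #|S|.
  rewrite /collection_degree big_tnth -sum1_card.
  rewrite (eq_bigl (fun x => true && (x.2 \in rcosets (H x.1) G))); last first.
    by move=> x; rewrite inE.
  rewrite -(pair_big_dep predT (fun i C => C \in rcosets (H i) G) (fun _ _ => 1%N)) /=.
  by apply: eq_bigr => i _; rewrite sum1_card.
apply: embeds_in_Sym_action actsG _; apply/eqP; rewrite eqEsubset sub1G andbT.
apply/subsetP=> g /setIP[Gg /astabP fix_g]; apply/set1P/faith_t => // K x tK Gx.
have [i ->] : exists i, K = tnth (in_tuple t) i by apply/tnthP.
have /fix_g : (i, H i :* x^-1) \in S.
  by rewrite inE; apply/rcosetsP; exists x^-1; rewrite ?groupV.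
case=> E; have : x^-1 * g \in H i :* x^-1.
  by rewrite -E mem_rcoset mulgK rcoset_refl.
by rewrite mem_rcoset invgK -mulgA.
Qed.

(** The stabilisers of one point from each orbit of the image, pulled back to [G], have the lengths
    of the orbits as indices. With the converse construction, [perm_degree] is the least degree of a
    faithful collection. *)
Lemma collection_of_embedding G m : embeds_in_Sym G m ->
  exists2 t, faithful_collection G t & collection_degree G t = m.
Proof.
case/existsP=> K /isogP[f injf fG].
pose R := orbit_transversal 'P K [set: 'I_m].
have actsK : [acts K, on [set: 'I_m] | 'P] by apply/actsP=> g _ i; rewrite !inE.
have [trR sRS eqR exR] := orbit_transversalP actsK.
pose t := [seq (f @*^-1 'C_K[i | 'P])%G | i <- enum R].
exists t.
  apply/faithful_collectionP; split=> [_ /mapP[i _ ->]|x Gx fix_x].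
    exact: subsetIl.
  apply: (injmP injf) => //; rewrite morph1; apply/permP=> i; rewrite perm1.
  have [k Kk Ri] := exR i (in_setT i).
  move: Kk Ri; rewrite -{1}fG => /morphimP[g _ Gg ->] Ri.
  have : x ^ g \in (f @*^-1 'C_K['P%act i (f g) | 'P])%G.
    by apply: fix_x => //; apply/mapP; exists ('P%act i (f g)); rewrite ?mem_enum.
  case/morphpreP=> _ /setIP[_ /astab1P].
  by rewrite morphJ // -actCJ => /act_inj.
rewrite /collection_degree big_map big_enum /=.
have idx i : #|G : f @*^-1 'C_K[i | 'P]| = #|orbit 'P K i|.
  rewrite card_orbit -(index_morphpre (f := f) (L := K) 'C_K[i | 'P]%G); last by rewrite fG.
  congr #|_ : _|; rewrite -fG morphimGK //; exact: subset_trans (sub1G _).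
rewrite (eq_bigr _ (fun i _ => idx i)) -(big_imset (fun O : {set 'I_m} => #|O|)) /=; last first.
  by move=> i j Ri Rj eq_ij; apply/eqP; rewrite -eqR // eq_ij orbit_refl.
suff -> : [set orbit 'P K i | i in R] = orbit 'P K @: [set: 'I_m].
  by rewrite acts_sum_card_orbit // cardsT card_ord.
apply/setP=> O; apply/imsetP/imsetP=> [[i _ ->]|[i _ ->]]; first by exists i.
by have [k Kk Ri] := exR i (in_setT i); exists ('P%act i k); rewrite ?orbit_act.
Qed.

Lemma perm_degree_minimal_faithful G t :
  minimal_faithful G t -> perm_degree G = collection_degree G t.
Proof.
case=> faith_t min_t; rewrite /perm_degree; case: ex_minnP => m Gm min_m.
apply/eqP; rewrite eqn_leq min_m ?embeds_in_Sym_collection //.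
by have [u faith_u <-] := collection_of_embedding Gm; apply: min_t.
Qed.
End PermutationDegree.

Lemma two_neq0_odd_card (F : finFieldType) : odd #|F| -> (2%:R : F)%R != 0%R.
Proof.
move=> oddF; apply/eqP=> two0.
have : ((1 : F) *+ #|F|)%R = 0%R.
  by rewrite -FinRing.zmodXgE -cardsT expg_cardG ?inE.
rewrite -[#|F|]odd_double_half oddF mulrnDr -muln2 mulnC mulrnA.
by rewrite two0 mul0rn addr0 => /eqP; rewrite oner_eq0.
Qed.

(** Induction from [x + y <= x * y] for [x, y >= 2]. It turns the factor gained from a subgroup
    avoiding several primes into the sum of the contributions of these primes. *)
Lemma leq_sum_prod (s : seq nat) : s != [::] -> all (leq 2) s ->
  (\sum_(x <- s) x <= \prod_(x <- s) x)%N.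
Proof.
case: s => // x s _; elim: s x => [|y s IH] x; first by rewrite !big_seq1.
move=> /andP[x2 ys2]; have := IH y ys2; rewrite !(big_cons _ _ x).
have : (2 <= \sum_(z <- y :: s) z)%N.
  by case/andP: ys2 => y2 _; rewrite big_cons (leq_trans y2) // leq_addr.
have arith a b : (2 <= a -> a <= b -> x + a <= x * b)%N by move: x2; clear; nia.
exact: arith.
Qed.

Lemma partn_seq (n : nat) (J : seq nat) : (0 < n)%N -> uniq J ->
  {subset J <= primes n} -> (n`_[pred p in J] = \prod_(p <- J) p ^ logn p n)%N.
Proof.
move=> n0 uJ sJ; rewrite /partn -big_filter; apply: perm_big; apply: uniq_perm => //.
  by rewrite filter_uniq // iota_uniq.
move=> p; rewrite mem_filter mem_index_iota /= inE andb_idr // => /sJ.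
by rewrite mem_primes ltnS => /and3P[_ _ /dvdn_leq->].
Qed.

(** * Groups of transvections *)

Local Open Scope ring_scope.

Lemma separating_form (F : fieldType) k (x w : 'cV[F]_k) (a : F) :
  ~~ (x^T <= w^T)%MS -> exists f : 'rV_k, f *m w = 0 /\ f *m x = a%:M.
Proof.
rewrite submxE => /matrix0Pn[i [j]]; set y := _ *m _ => y0.
exists (a *: ((y i j)^-1 *: (col j (cokermx w^T))^T)); split.
  rewrite -!scalemxAl -[_ *m w]trmxK trmx_mul trmxK colE mulmxA mulmx_coker.
  by rewrite mul0mx trmx0 !scaler0.
rewrite -!scalemxAl -[_ *m x]trmxK trmx_mul trmxK colE mulmxA -colE -/y.
rewrite [_^T]mx11_scalar !mxE (ord1 i) in y0 *.
by rewrite scale_scalar_mx mulVf // scalemx1.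
Qed.

Lemma notin_rowspace (F : fieldType) m k (W : 'M[F]_(m, k)) : (m < k)%N ->
  exists x : 'cV_k, ~~ (x^T <= W)%MS.
Proof.
move=> mk; have /row_subPn[i] : ~~ ((1%:M : 'M[F]_k) <= W)%MS.
  apply/negP=> /mxrankS; rewrite mxrank1 => /leq_trans/(_ (rank_leq_row _)); lia.
by move=> xi; exists (row i 1%:M)^T; rewrite trmxK.
Qed.

(** Stated for any transitive relation containing the moves by transvections, since it serves both
    for conjugacy within a root group and for transitivity on nonzero vectors. *)
Lemma transvection_connected (F : fieldType) k (e : 'cV[F]_k -> 'cV[F]_k -> Prop) :
  (1 < k)%N -> (forall y x z, e x y -> e y z -> e x z) ->
  (forall (w : 'cV_k) (f : 'rV_k) x, f *m w = 0 -> e x (x + w *m (f *m x))) ->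
  forall x y, x != 0 -> y != 0 -> e x y.
Proof.
move=> k1 e_trans e_tv.
(* A form killing [y - x] with value 1 at [x] gives a transvection from [x] to [y]. *)
have direct x y : ~~ (x^T <= (y - x)^T)%MS -> e x y.
  case/(separating_form 1)=> f [fyx fx].
  by have := e_tv _ f x fyx; rewrite fx mulmx1 addrC subrK.
move=> x y x0 y0; have [/sub_rVP[a xE]|/direct//] := boolP (x^T <= (y - x)^T)%MS.
(* Here [y] is a multiple of [x], and any [z] off their line is joined to both. *)
have [z zx] := notin_rowspace x^T k1.
apply: (e_trans z); apply: direct.
  apply: contra zx => /sub_rVP[b]; rewrite linearB /= scalerBr => E.
  have b0 : b != 0 by apply: contraNneq x0 => b0; rewrite -trmx_eq0 E b0 !scale0r subrr.
  apply/sub_rVP; exists (b^-1 * (1 + b)).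
  rewrite -scalerA scalerDl scale1r [X in X + _]E subrK scalerA mulVf //.
  by rewrite scale1r.
have a0 : a != 0 by apply: contraNneq x0 => a0; rewrite -trmx_eq0 xE a0 scale0r.
have {xE}yE : y^T = a^-1 *: x^T + x^T.
  by rewrite {1}xE scalerA mulVf // scale1r linearB subrK.
apply: contra zx => /sub_rVP[b]; rewrite linearB /= scalerBr => E.
have E1 : (1 + b) *: z^T = b *: y^T by rewrite scalerDl scale1r [X in X + _]E subrK.
have [b1|b1] := eqVneq (1 + b) 0.
  move: E1; rewrite b1 scale0r => /esym/eqP; rewrite scaler_eq0 trmx_eq0 (negPf y0) orbF.
  by move=> /eqP b0; move: b1; rewrite b0 addr0 => /eqP; rewrite oner_eq0.
apply/sub_rVP; exists ((1 + b)^-1 * b * (a^-1 + 1)).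
rewrite -scalerA scalerDl scale1r -yE -scalerA -E1 scalerA mulVf //.
by rewrite scale1r.
Qed.

(** * An abstract vector group of transvections acting on few points *)

Section TransvectionModule.
Variables (F : finFieldType) (k : nat) (gT : finGroupType) (T : finType).
Variables (to : {action gT &-> T}) (G : {group gT}) (S : {set T}).
Variable iota : 'cV[F]_k -> gT.
Hypothesis k_gt1 : (1 < k)%N.
Hypothesis actG : [transitive G, on S | to].
Hypothesis iotaD : {morph iota : x y / x + y >-> (x * y)%g}.
Hypothesis iota_inj : injective iota.
Hypothesis iotaG : forall x, iota x \in G.
Hypothesis iota_tv : forall (w : 'cV_k) (f : 'rV_k), f *m w = 0 ->
  exists2 g, g \in G & forall x, (iota x ^ g)%g = iota (x + w *m (f *m x)).
Hypothesis S_small : (#|S| < 2 * #|F| ^ k)%N.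
Variables (x0 : 'cV[F]_k) (s0 : T).
Hypothesis Ss0 : s0 \in S.
Hypothesis x0s0 : to s0 (iota x0) != s0.

Let N := (#|F| ^ k)%N.

Let iota0 : iota 0 = 1%g.
Proof. by apply: (mulgI (iota 0)); rewrite -iotaD addr0 mulg1. Qed.

Let iotaN x : iota (- x) = (iota x)^-1%g.
Proof. by apply/eqP; rewrite eq_sym eq_invg_mul -iotaD subrr iota0. Qed.

Fact transvection_module_group_set : group_set (iota @: [set: 'cV[F]_k]).
Proof.
apply/group_setP; split=> [|_ _ /imsetP[x _ ->] /imsetP[y _ ->]].
  by rewrite -iota0 imset_f ?inE.
by rewrite -iotaD imset_f ?inE.
Qed.

Let Q := Group transvection_module_group_set.

Let QP u : reflect (exists x, u = iota x) (u \in Q).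
Proof.
by apply: (iffP imsetP) => [[x _ ->]|[x ->]]; exists x => //; rewrite inE.
Qed.

Let cardQ : #|Q| = N.
Proof. by rewrite card_imset // cardsT card_mx muln1. Qed.

Let sQG : Q \subset G.
Proof. by apply/subsetP=> _ /QP[x ->]. Qed.

Let abQ : abelian Q.
Proof.
by apply/centsP=> _ /QP[x ->] _ /QP[y ->]; rewrite /commute -!iotaD addrC.
Qed.

Let actsG : [acts G, on S | to].
Proof. exact: atrans_acts. Qed.

Let actsQ : [acts Q, on S | to].
Proof. exact: subset_trans sQG actsG. Qed.

Let toS g s : g \in G -> s \in S -> to s g \in S.
Proof. by move=> Gg; rewrite (acts_act actsG). Qed.

Lemma iota_conj x y : x != 0 -> y != 0 ->
  exists2 g, g \in G & (iota x ^ g)%g = iota y.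
Proof.
move: x y; apply: (transvection_connected k_gt1)
  => [y x z [g Gg E] [h Gh E']|w f x /iota_tv[g Gg E]].
  by exists (g * h)%g; rewrite ?groupM // conjgM E.
by exists g.
Qed.

Let f := #|'Fix_(S | to)[iota x0]|.

Let x0_neq0 : x0 != 0.
Proof. by apply: contraNneq x0s0 => ->; rewrite iota0 act1. Qed.

Let fixQ : {in Q^#, forall u, #|'Fix_(S | to)[u]| = f}.
Proof.
move=> u; rewrite !inE => /andP[u1 /QP[x uE]].
have x_neq0 : x != 0 by apply: contraNneq u1 => x0E; rewrite uE x0E iota0.
have [g Gg] := iota_conj x0_neq0 x_neq0; rewrite -uE => <-.
rewrite -[RHS](card_imset _ (act_inj to g)); congr #|pred_of_set _|.
apply/setP=> s; rewrite -[s](actKV to g) (mem_imset _ _ (act_inj to g)) !inE.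
rewrite (acts_act actsG Gg) !sub1set !inE.
by rewrite -actCJ (inj_eq (act_inj to g)).
Qed.

(** The number [#|S| - f] of moved points is positive, a multiple of [N] and less than [2 * N]. *)
Let cardS : #|S| = (f + #|Q|)%N.
Proof.
have fS : (f < #|S|)%N.
  apply/proper_card/properP; split; first exact: subsetIl.
  by exists s0 => //; rewrite !inE sub1set inE negb_and x0s0 orbT.
have /dvdnP[a aE] := constant_fixity_moved_dvd actsQ fixQ fS.
have N0 := cardG_gt0 Q; rewrite cardQ -/N in aE N0 *; move: S_small; rewrite -/N.
have : a = 1%N \/ a = 0%N \/ (2 <= a)%N by lia.
by case=> [aE1|[aE0|a2]]; nia.
Qed.

Definition stab_vec s := [pred x | to s (iota x) == s].

Lemma stab_vecP s x : reflect (to s (iota x) = s) (x \in stab_vec s).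
Proof. by rewrite inE; apply: eqP. Qed.

Lemma stab_vec0 s : 0 \in stab_vec s.
Proof. by rewrite inE iota0 act1. Qed.

Lemma stab_vecD s x y : x \in stab_vec s -> y \in stab_vec s -> x + y \in stab_vec s.
Proof. by move=> /stab_vecP xs /stab_vecP ys; rewrite inE iotaD actM xs ys. Qed.

Lemma stab_vecN s x : x \in stab_vec s -> - x \in stab_vec s.
Proof. by move=> /stab_vecP xs; rewrite inE iotaN -{1}xs actK. Qed.

Lemma stab_vecB s x y : x \in stab_vec s -> y \in stab_vec s -> x - y \in stab_vec s.
Proof. by move=> xs /stab_vecN; apply: stab_vecD. Qed.

Let stabQ s x : (iota x \in 'C_Q[s | to]) = (x \in stab_vec s).
Proof.
rewrite inE; have -> : iota x \in Q by apply/QP; exists x.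
by apply/astab1P/stab_vecP.
Qed.

(* As R_s and R_(s g) are either equal (same Q-orbit) or span everything,
   R := stab_vec s is stable under the transvection 1 + w f or R + (1 + w f) R
   is the full space. *)
Lemma stab_vec_transvection s (w : 'cV_k) (h : 'rV_k) : s \in S -> h *m w = 0 ->
  {in stab_vec s, forall x, w *m (h *m x) \in stab_vec s} \/
  (forall y, exists2 x, x \in stab_vec s & exists a, y = x + a *: w).
Proof.
move=> Ss hw; have [g Gg gE] := iota_tv hw.
have sgE x : (x + w *m (h *m x) \in stab_vec (to s g)) = (x \in stab_vec s).
  by rewrite !inE -gE -actCJ (inj_eq (act_inj to g)).
have [/orbitP[u /QP[y uE] sg]|sgQ] := boolP (to s g \in orbit to Q s).
  left=> x xs; have : x + w *m (h *m x) \in stab_vec s.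
    have: x + w *m (h *m x) \in stab_vec (to s g) by rewrite sgE.
    rewrite -sg uE !inE; move: (x + _) => z.
    by rewrite -actM -iotaD addrC iotaD actM (inj_eq (act_inj to _)).
  by move/stab_vecB/(_ xs); rewrite addrAC subrr add0r.
(* The stabiliser of [s] is transitive on the orbit of [to s g], which is another orbit of [Q], so
   the stabilisers of these two points together span the space. *)
right=> y; have := orbit_stab_other_orbit actsQ fixQ cardS abQ Ss (toS Gg Ss) sgQ.
move/setP/(_ (to (to s g) (iota y))).
rewrite [RHS]mem_orbit => [|]; last by rewrite imset_f ?inE.
case/orbitP=> u Ru; have /QP[x uE] : u \in Q by apply: subsetP Ru; apply: subsetIl.
rewrite uE in Ru * => E.
have : y - x \in stab_vec (to s g).
  by rewrite inE iotaD actM -E -actM -iotaD subrr iota0 act1.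
set z := y - x; pose x' := z - w *m (h *m z).
have zE : z = x' + w *m (h *m x').
  by rewrite mulmxBr [h *m (w *m _)]mulmxA hw mul0mx subr0 subrK.
rewrite zE sgE => x's; exists (x + x').
  by apply: stab_vecD => //; rewrite -stabQ.
exists ((h *m x') 0 0); apply/esym; rewrite -mul_mx_scalar -mx11_scalar -addrA -zE.
by rewrite addrC subrK.
Qed.

Definition spans s (w : 'cV[F]_k) :=
  [forall y : 'cV_k, [exists a, y - a *: w \in stab_vec s]].

(** This is [stab_vec_transvection] for a form killing [w] and taking the value [a] at [x]. *)
Lemma stab_vec_line s (w x : 'cV_k) a : s \in S -> ~~ spans s w ->
  x \in stab_vec s -> ~~ (x^T <= w^T)%MS -> a *: w \in stab_vec s.
Proof.
move=> Ss not_spans xs /(separating_form a)[h [hw hx]].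
have [/(_ _ xs)|span] := stab_vec_transvection Ss hw.
  by rewrite hx mul_mx_scalar.
case/forallP: not_spans => y; apply/existsP.
by have [z zs [b ->]] := span y; exists b; rewrite addrK.
Qed.

(** If no line spans the space together with the stabiliser, a nonzero [u] in the stabiliser brings
    in, by [stab_vec_line], every vector off its line, and such vectors generate everything. *)
Lemma stab_vec_cases s : s \in S ->
  [\/ forall x, x \in stab_vec s -> x = 0, forall x, x \in stab_vec s
    | exists w, spans s w].
Proof.
move=> Ss; have [/existsP|] := boolP [exists w, spans s w]; first by constructor 3.
rewrite negb_exists => /forallP noline.
have [/existsP[u /andP[u0 us]]|] := boolP [exists u, (u != 0) && (u \in stab_vec s)];
  last first.
  rewrite negb_exists => /forallP R0; constructor 1 => x xs.
  by have := R0 x; rewrite xs andbT negbK => /eqP.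
constructor 2.
have offline w : ~~ (w^T <= u^T)%MS -> w \in stab_vec s.
  move=> wu; rewrite -[w]scale1r; apply: stab_vec_line (noline w) us _ => //.
  apply: contra wu => /sub_rVP[a uE]; apply/sub_rVP; exists a^-1.
  have a0 : a != 0 by apply: contraNneq u0 => a0; rewrite -trmx_eq0 uE a0 scale0r.
  by rewrite uE scalerA mulVf // scale1r.
move=> x; have [xu|/offline//] := boolP (x^T <= u^T)%MS.
have [z zu] := notin_rowspace u^T k_gt1.
rewrite -[x](addrK z); apply: stab_vecB; apply: offline => //.
apply: contra zu => xzu; rewrite -[z](addKr x) linearD linearN /=.
by rewrite addmx_sub ?eqmx_opp.
Qed.

Lemma card_orbit_spans s w : spans s w -> (#|orbit to Q s| <= #|F|)%N.
Proof.
move/forallP=> span; rewrite -cardsT.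
apply: leq_trans (leq_imset_card (fun a => to s (iota (a *: w))) _).
apply/subset_leq_card/subsetP=> _ /orbitP[_ /QP[y ->] <-].
have /existsP[a /stab_vecP yE] := span y.
by apply/imsetP; exists a => //; rewrite -{2}yE -actM -iotaD subrK.
Qed.

Lemma stab_vec_orbit s s' : s' \in orbit to Q s -> stab_vec s' =i stab_vec s.
Proof.
case/orbitP=> _ /QP[y ->] <- x.
by rewrite !inE -actM -iotaD addrC iotaD actM (inj_eq (act_inj to _)).
Qed.

(** The trivial stabiliser of [s] is transitive on the orbit of [s'], which is thus a single
    point. *)
Lemma free_orbit_others s s' y : s \in S -> s' \in S ->
  (forall x, x \in stab_vec s -> x = 0) -> s' \notin orbit to Q s ->
  y \in stab_vec s'.
Proof.
move=> Ss Ss' R0 s's.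
have /setP/(_ (to s' (iota y))) := orbit_stab_other_orbit actsQ fixQ cardS abQ Ss Ss' s's.
rewrite [RHS]mem_orbit => [/orbitP[u Ru]|]; last by rewrite imset_f ?inE.
have /QP[x uE] : u \in Q by apply: subsetP Ru; apply: subsetIl.
by move: Ru; rewrite uE stabQ => /R0->; rewrite iota0 act1 => E; apply/stab_vecP; rewrite -E.
Qed.

(** The bound says [#|S| < d - 1], where [d - 1 = q (N - 1) / (q - 1)]. An orbit with more than
    [#|F|] points is regular by [stab_vec_cases], and then [Q] fixes all points outside it. If there
    is none, the [f + 1] orbits cover at most [(f + 1) * #|F|] points, too few for [f + N]. *)
Lemma stab_vec_all_or_none s x y : (#|S| * (#|F| - 1) < #|F| * (N - 1))%N ->
  s \in S -> x != 0 -> x \in stab_vec s -> y \in stab_vec s.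
Proof.
move=> lt_S Ss xn0 xs.
have [s1 /andP[Ss1 s1_big]|] := pickP (fun s => (s \in S) && (#|F| < #|orbit to Q s|)%N).
  have R0 : forall z, z \in stab_vec s1 -> z = 0.
    have [//|RT|[w /card_orbit_spans]] := stab_vec_cases Ss1; last by rewrite leqNgt s1_big.
    have /subset_leq_card : orbit to Q s1 \subset [set s1].
      by apply/subsetP=> _ /orbitP[_ /QP[z ->] <-]; rewrite inE; apply: RT.
    rewrite cards1 => /(leq_trans s1_big); rewrite ltnS leqn0 => /eqP q0.
    by have := card_finRing_gt1 F; rewrite q0.
  have [ss1|ss1] := boolP (s \in orbit to Q s1); last exact: free_orbit_others Ss1 Ss R0 ss1.
  by move: xn0; rewrite (stab_vec_orbit ss1) in xs; rewrite (R0 _ xs) eqxx.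
move=> small; have : (#|S| <= #|orbit to Q @: S| * #|F|)%N.
  rewrite -(acts_sum_card_orbit actsQ) -sum_nat_const.
  apply: leq_sum => _ /imsetP[z Sz ->].
  by have := small z; rewrite Sz /= => /negbT; rewrite -leqNgt.
rewrite (card_orbits_moved1 actsQ fixQ cardS); move: lt_S; rewrite cardS cardQ -/N.
have : (0 < N)%N by rewrite -cardQ cardG_gt0.
have := card_finRing_gt1 F; clear; nia.
Qed.

(** Were the orbit of [s] regular, [Q] would fix every point outside it, and an element of [X],
    which normalises [Q], would carry such a point to [s]. *)
Lemma stab_vec_nontrivial (X : {group gT}) s : [transitive X, on S | to] ->
  (forall g x, g \in X -> exists y, (iota x ^ g)%g = iota y) -> (N < #|S|)%N -> s \in S ->
  exists2 x, x != 0 & x \in stab_vec s.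
Proof.
move=> trX nQX ltNS Ss.
have [/existsP[x /andP[]]|] := boolP [exists x, (x != 0) && (x \in stab_vec s)].
  by exists x.
rewrite negb_exists => /forallP R0.
have {}R0 x : x \in stab_vec s -> x = 0.
  by move=> xs; have := R0 x; rewrite xs andbT negbK => /eqP.
have : (0 < #|S :\: orbit to Q s|)%N.
  rewrite cardsD subn_gt0; apply: leq_ltn_trans ltNS; rewrite -cardQ.
  apply: leq_trans (subset_leq_card (subsetIr _ _)) _.
  by rewrite card_orbit dvdn_leq // dvdn_indexg.
case/card_gt0P=> s'; rewrite inE => /andP[s's Ss'].
have fixs' y := free_orbit_others y Ss Ss' R0 s's.
have [g Xg sE] := atransP2 trX Ss' Ss.
have [x1 x10] : exists x : 'cV[F]_k, x != 0 by exists x0.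
have [y yE] := nQX g^-1%g x1 (groupVr Xg); exists x1 => //.
by rewrite sE inE; apply/eqP; rewrite -[iota x1](conjgKV g) yE -actCJ; have /stab_vecP-> := fixs' y.
Qed.

(** Each of the [f + 1] orbits has at most [#|F|] points, while the hypothesis on [#|S|] amounts to
    [f + N = (f + 1) * #|F|]. *)
Lemma card_orbit_critical s : (#|S| * (#|F| - 1) = #|F| * (N - 1))%N ->
  (forall t, t \in S -> exists2 x, x != 0 & x \in stab_vec t) ->
  s \in S -> #|orbit to Q s| = #|F|.
Proof.
move=> critS R_neq0 Ss.
have le_q t : t \in S -> (#|orbit to Q t| <= #|F|)%N.
  move=> St; have [x x_neq0 xt] := R_neq0 t St.
  have [R0|RT|[w /card_orbit_spans//]] := stab_vec_cases St.
    by rewrite (R0 x xt) eqxx in x_neq0.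
  have /subset_leq_card : orbit to Q t \subset [set t].
    by apply/subsetP=> _ /orbitP[_ /QP[z ->] <-]; rewrite inE; apply: RT.
  by rewrite cards1 => /leq_trans-> //; apply: ltnW; apply: card_finRing_gt1.
have POs : orbit to Q s \in orbit to Q @: S by apply: imset_f.
apply/eqP; rewrite eqn_leq le_q //=.
have := acts_sum_card_orbit actsQ; rewrite (bigD1 _ POs) /=.
set r := \sum_(i | _) _ => sumE.
have : (r <= \sum_(O in orbit to Q @: S | O != orbit to Q s) #|F|)%N.
  by apply: leq_sum => _ /andP[/imsetP[t St ->] _]; apply: le_q.
rewrite sum_nat_const.
have : (#|[pred O in orbit to Q @: S | O != orbit to Q s]|).+1 = (#|S| - N).+1.
  rewrite cardS cardQ addnK -(card_orbits_moved1 actsQ fixQ cardS).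
  rewrite [RHS](cardD1 (orbit to Q s)) POs add1n; congr _.+1.
  by apply: eq_card => O; rewrite !inE andbC.
case=> E; rewrite [#|_|]E; move: critS sumE; rewrite cardS cardQ -/N addnK.
have : (0 < N)%N by rewrite -cardQ cardG_gt0.
have := card_finRing_gt1 F; clear; case: #|F| => // q; move: #|_| => o.
rewrite subn1 /= => q0 N0 E1 E2 E3; have : (f * q + q.+1 = N)%N by nia.
by nia.
Qed.

(** If [w] did not span the space with the stabiliser [R], then [stab_vec_line] would put [R] on the
    line of [w], and [R] with the line of [w1] would fill at most two dimensions. Independence holds
    because the orbit has [#|F|] points, all reached along the line of [w]. *)
Lemma stab_vec_complement s w : (2 < k)%N ->
  (#|S| * (#|F| - 1) = #|F| * (N - 1))%N ->
  (forall t, t \in S -> exists2 x, x != 0 & x \in stab_vec t) ->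
  s \in S -> w \notin stab_vec s ->
  (forall y, exists a, y - a *: w \in stab_vec s) /\
  (forall a, a *: w \in stab_vec s -> a = 0).
Proof.
move=> k2 critS R_neq0 Ss wR.
have [x x_neq0 xs] := R_neq0 s Ss.
have [R0|RT|[w1 /forallP span1]] := stab_vec_cases Ss.
- by rewrite (R0 x xs) eqxx in x_neq0.
- by rewrite RT in wR.
have span : spans s w.
  apply: contraT => not_spans.
  have Rw z : z \in stab_vec s -> (z^T <= w^T)%MS.
    move=> zs; apply: contraR wR => zw; rewrite -[w]scale1r.
    exact: stab_vec_line Ss not_spans zs zw.
  have [z] := notin_rowspace (col_mx w^T w1^T) k2.
  have /existsP[a /Rw zw] := span1 z.
  rewrite -[z](subrK (a *: w1)) linearD addmx_sub //.
    by apply: submx_trans zw _; rewrite -addsmxE addsmxSl.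
  by rewrite linearZ scalemx_sub // -addsmxE addsmxSr.
split=> [y|a aw]; first by apply/existsP; have /forallP := span.
pose h (b : F) := to s (iota (b *: w)).
suff h_inj : injective h.
  by apply: h_inj; rewrite /h scale0r iota0 act1; apply/stab_vecP.
apply/injectiveP; rewrite /injectiveb /dinjectiveb -/(image h F).
apply/card_uniqP; rewrite size_map -cardE -(card_orbit_critical critS R_neq0 Ss).
apply: eq_card => t; apply/mapP/orbitP => [[b _ ->]|[_ /QP[y ->] <-]].
  by exists (iota (b *: w)) => //; apply/QP; exists (b *: w).
have /existsP[b /stab_vecP yE] := forallP span y.
by exists b; rewrite ?mem_enum // /h -{2}yE -actM -iotaD subrK.
Qed.

Lemma card_moved : #|S| = (f + N)%N.
Proof. by rewrite cardS cardQ. Qed.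

Lemma transvection_module_orbit s : s \in S ->
  (forall x, x \in stab_vec s -> x = 0) -> f = 0%N ->
  forall t, t \in S -> exists x, t = to s (iota x).
Proof.
move=> Ss R0 f0 t St.
have orbS : orbit to Q s = S.
  apply/eqP; rewrite eqEcard acts_sub_orbit // Ss card_moved f0 -cardQ.
  rewrite card_orbit (_ : 'C_Q[s | to] = 1%g) ?indexg1 ?add0n ?leqnn //.
  apply/eqP; rewrite eqEsubset sub1G andbT; apply/subsetP=> u Ru.
  have /QP[x uE] := subsetP (subsetIl _ _) u Ru.
  by move: Ru; rewrite uE stabQ => /R0->; rewrite iota0 inE.
by move: St; rewrite -{1}orbS => /orbitP[_ /QP[x ->] <-]; exists x.
Qed.
End TransvectionModule.

(** * Generation and perfectness of the special linear group *)

Lemma kernel_notin_line (F : fieldType) m n (U : 'M[F]_(m, n)) (c : 'cV_n) :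
  (m.+1 < n)%N -> exists d : 'cV_n, U *m d = 0 /\ ~~ (d^T <= c^T)%MS.
Proof.
move=> mn; have /row_subPn[i iN] : ~~ (kermx U^T <= c^T)%MS.
  apply/negP=> /mxrankS; rewrite mxrank_ker mxrank_tr.
  have := rank_leq_row U; have := rank_leq_row c^T; lia.
exists (row i (kermx U^T))^T; rewrite trmxK; split=> //.
apply: trmx_inj; rewrite trmx_mul trmxK trmx0.
by apply/sub_kermxP; apply: row_sub.
Qed.

(** The matrix determinant lemma, from two block triangular factorisations of [A]. *)
Lemma det_1Dcolrow (R : comNzRingType) n (c : 'cV[R]_n) (f : 'rV_n) :
  \det (1%:M + c *m f) = 1 + (f *m c) 0 0.
Proof.
pose A := block_mx (1%:M : 'M_n) c (- f) (1%:M : 'M_1).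
have E1 : A = block_mx 1%:M 0 (- f) 1%:M *m block_mx 1%:M c 0 (1%:M + f *m c).
  rewrite mulmx_block ?(mulmx1, mul1mx, mul0mx, mulmx0, addr0).
  by rewrite mulNmx addrC -addrA subrr addr0.
have E2 : A = block_mx (1%:M + c *m f) c 0 1%:M *m block_mx 1%:M 0 (- f) 1%:M.
  rewrite mulmx_block ?(mulmx1, mul1mx, mul0mx, mulmx0, add0r).
  by rewrite mulmxN addrK.
have : \det A = \det A by [].
rewrite {1}E1 E2 !det_mulmx !det_ublock !det_lblock !det1 !mul1r !mulr1 => <-.
by rewrite det_mx11 !mxE eqxx.
Qed.

Section TransvectionProducts.
Variable F : fieldType.

Inductive transvection_product n : 'M[F]_n -> Prop :=
| TransvectionProduct1 : transvection_product 1%:M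
| TransvectionProductM (c : 'cV_n) (f : 'rV_n) A : f *m c = 0 ->
    transvection_product A -> transvection_product ((1%:M + c *m f) *m A).

Lemma transvection_productM n (A B : 'M_n) :
  transvection_product A -> transvection_product B -> transvection_product (A *m B).
Proof.
move=> tA tB; elim: tA => [|c f A' fc _ IH]; first by rewrite mul1mx.
by rewrite -mulmxA; constructor.
Qed.

Lemma transvection_product1 n (c : 'cV_n) (f : 'rV_n) :
  f *m c = 0 -> transvection_product (1%:M + c *m f).
Proof. by move=> fc; rewrite -[_ + _]mulmx1; do !constructor. Qed.

Lemma det_transvection_product n (A : 'M_n) : transvection_product A -> \det A = 1.
Proof.
elim=> [|c f A' fc _ IH]; first exact: det1.
by rewrite det_mulmx IH det_1Dcolrow fc mxE addr0 mulr1.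
Qed.

Lemma transvection_product_lift m n (A : 'M_n) :
  transvection_product A -> transvection_product (block_mx (1%:M : 'M_m) 0 0 A).
Proof.
elim=> [|c f A' fc _ IH]; first by rewrite -scalar_mx_block; constructor.
suff -> : block_mx (1%:M : 'M_m) 0 0 ((1%:M + c *m f) *m A') =
    (1%:M + col_mx 0 c *m row_mx 0 f) *m block_mx 1%:M 0 0 A'.
  by constructor=> //; rewrite mul_row_col fc mulmx0 addr0.
rewrite mul_col_row !mulmx0 mul0mx (scalar_mx_block m n) add_block_mx mulmx_block.
by rewrite !addr0 !mulmx0 !mulmx1 !mul0mx !addr0 add0r.
Qed.

Lemma transvection_product_trans k (x y : 'cV_k) : (1 < k)%N -> x != 0 -> y != 0 ->
  exists A, transvection_product A /\ A *m x = y.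
Proof.
move=> k1; move: x y; apply: (transvection_connected k1).
  move=> y x z [A [tA xy]] [B [tB yz]]; exists (B *m A).
  by rewrite -mulmxA xy yz; split=> //; apply: transvection_productM.
move=> w f x fw; exists (1%:M + w *m f); split; first exact: transvection_product1.
by rewrite mulmxDl mul1mx mulmxA.
Qed.

(** By induction: a product [T] of transvections sends [e0] to [A *m e0], so [invmx T *m A] has
    first column [e0], and up to one more transvection it is a lift of a matrix of size one less. *)
Lemma det1_transvection_product n (A : 'M_n) : \det A = 1 -> transvection_product A.
Proof.
elim: n A => [|[|n] IH] A dA.
- suff -> : A = 1%:M by constructor.
  by rewrite [LHS]flatmx0 [RHS]flatmx0.
- suff -> : A = 1%:M by constructor.
  by rewrite [A]mx11_scalar; rewrite det_mx11 in dA; rewrite dA.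
pose e0 : 'cV[F]_(1 + n.+1) := col_mx 1%:M 0.
pose A1 : 'M[F]_(1 + n.+1) := A.
have e0E : A1 *m e0 = col_mx (ulsubmx A1) (dlsubmx A1).
  by rewrite -{1}[A1]submxK mul_block_col !mulmx1 !mulmx0 !addr0.
have e00 : e0 != 0.
  by apply/eqP=> /(congr1 usubmx); rewrite col_mxKu => /eqP; rewrite linear0 oner_eq0.
have uA : A1 \in unitmx by rewrite unitmxE dA unitr1.
have Ae0 : A1 *m e0 != 0.
  by apply: contraNneq e00 => /(congr1 (mulmx (invmx A1))); rewrite mulKmx // mulmx0 => ->.
have [T [tT TE]] := @transvection_product_trans (1 + n.+1) _ _ isT e00 Ae0.
have uT : T \in unitmx by rewrite unitmxE (det_transvection_product tT) unitr1.
have -> : A = T *m (invmx T *m A1) :> 'M_(1 + n.+1) by rewrite mulKVmx.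
apply: transvection_productM => //.
have := det_mulmx (invmx T) A1; rewrite det_inv (det_transvection_product tT) dA invr1 mul1r.
have : invmx T *m A1 *m e0 = e0 by rewrite -mulmxA -TE mulKmx.
move: (invmx T *m A1) => B; rewrite -[B](submxK (m1 := 1) (n1 := 1)) /e0.
rewrite mul_block_col !mulmx1 !mulmx0 !addr0 => /eq_col_mx[-> ->].
rewrite det_ublock det1 mul1r => /IH/(transvection_product_lift 1).
set C := block_mx _ _ _ _ => tC.
have re0 : row_mx 0 (ursubmx B) *m e0 = 0.
  by rewrite mul_row_col mulmx0 mul0mx addr0.
have -> : block_mx 1%:M (ursubmx B) 0 (drsubmx B) =
   C *m (1%:M + e0 *m row_mx 0 (ursubmx B)).
  rewrite mul_col_row !mul0mx mulmx0 mul1mx (scalar_mx_block 1 n.+1) add_block_mx.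
  by rewrite mulmx_block !addr0 !mul1mx !mulmx1 !mul0mx !mulmx0 !add0r !addr0.
by apply: transvection_productM => //; apply: transvection_product1.
Qed.
End TransvectionProducts.

(* A name for the finite group type underlying {'GL_n[F]}: without it, unification
   keeps comparing different paths through the algebraic hierarchy. *)
Definition GLG (F : finFieldType) k : finGroupType := {'GL_k.+1[F]}.
Definition SLG (F : finFieldType) k : {group GLG F k} := SL_group k.+1 F.
Definition PG (F : finFieldType) k : {group GLG F k} := parabolic_group k.+1 F.
Definition GLmx (F : finFieldType) k (g : GLG F k) : 'M[F]_k.+1 := GLval g.

Section SpecialLinearTransvections.
Variables (F : finFieldType) (k : nat).
Let n := k.+1.

Lemma GLmx_inj : injective (@GLmx F k).
Proof. exact: val_inj. Qed.

Lemma GLmx1 : GLmx (1%g : GLG F k) = 1%:M.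
Proof. by []. Qed.

Lemma GLmxM (g h : GLG F k) : GLmx (g * h)%g = GLmx g *m GLmx h.
Proof. by []. Qed.

Lemma GLmx_unit (g : GLG F k) : GLmx g \in unitmx.
Proof. exact: (@GL_unitmx k.+1 F g). Qed.

Lemma mem_SLG (g : GLG F k) : (g \in SLG F k) = (\det (GLmx g) == 1).
Proof. by rewrite [LHS]inE. Qed.

Definition mxGL (A : 'M[F]_n) : GLG F k := insubd (1%g : {'GL_n[F]}) A.

Lemma mxGL_unit (A : 'M[F]_n) : A \in unitmx -> GLmx (mxGL A) = A.
Proof. by move=> uA; exact: (insubdK (1%g : {'GL_n[F]}) uA). Qed.

Lemma mxGLK (A : 'M[F]_n) : \det A = 1 -> GLmx (mxGL A) = A.
Proof. by move=> dA; rewrite mxGL_unit // unitmxE dA unitr1. Qed.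

Lemma mxGL_SL (A : 'M[F]_n) : \det A = 1 -> mxGL A \in SLG F k.
Proof. by move=> dA; rewrite mem_SLG mxGLK // dA. Qed.

Lemma mxGL_val (g : GLG F k) : mxGL (GLmx g) = g.
Proof. exact: valKd. Qed.

Lemma GLmx_mulV (g : GLG F k) : GLmx g *m GLmx g^-1%g = 1%:M.
Proof. by rewrite -GLmxM mulgV GLmx1. Qed.

Lemma GLmx_Vmul (g : GLG F k) : GLmx g^-1%g *m GLmx g = 1%:M.
Proof. by rewrite -GLmxM mulVg GLmx1. Qed.

Lemma SL_det (g : GLG F k) : g \in SLG F k -> \det (GLmx g) = 1.
Proof. by rewrite mem_SLG => /eqP. Qed.

Lemma mxGLM (A B : 'M[F]_n) : \det A = 1 -> \det B = 1 ->
  mxGL (A *m B) = (mxGL A * mxGL B)%g.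
Proof.
move=> dA dB; apply: GLmx_inj; rewrite GLmxM.
by rewrite !mxGLK // det_mulmx dA dB mulr1.
Qed.

Definition tv (c : 'cV[F]_n) (f : 'rV[F]_n) := mxGL (1%:M + c *m f).

Lemma tv_det (c : 'cV[F]_n) (f : 'rV[F]_n) : f *m c = 0 -> \det (1%:M + c *m f) = 1.
Proof. by move=> fc; rewrite det_1Dcolrow fc mxE addr0. Qed.

Lemma tvE (c : 'cV[F]_n) (f : 'rV[F]_n) : f *m c = 0 -> GLmx (tv c f) = 1%:M + c *m f.
Proof. by move=> fc; rewrite mxGLK ?tv_det. Qed.

Lemma tv_SL (c : 'cV[F]_n) (f : 'rV[F]_n) : f *m c = 0 -> tv c f \in SLG F k.
Proof. by move=> fc; rewrite mxGL_SL ?tv_det. Qed.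

Lemma tvJ (c : 'cV[F]_n) (f : 'rV[F]_n) (g : GLG F k) : f *m c = 0 ->
  (tv c f ^ g)%g = tv (GLmx g^-1%g *m c) (f *m GLmx g).
Proof.
move=> fc; apply: GLmx_inj; rewrite tvE; last first.
  by rewrite -!mulmxA [GLmx g *m _]mulmxA GLmx_mulV mul1mx.
by rewrite !GLmxM tvE // mulmxDl mul1mx mulmxDr GLmx_Vmul !mulmxA.
Qed.

Lemma SL_generated (K : {group GLG F k}) :
  (forall (c : 'cV_n) (f : 'rV_n), f *m c = 0 -> tv c f \in K) -> SLG F k \subset K.
Proof.
move=> tvK; apply/subsetP=> g /SL_det/det1_transvection_product tg.
rewrite -[g]mxGL_val; move: tg; rewrite -/n; move: (GLmx g : 'M_n) => A.
elim=> [|c f B fc tB IH].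
  suff -> : mxGL 1%:M = 1%g by apply: group1.
  by apply: GLmx_inj; rewrite mxGLK ?det1 ?GLmx1.
rewrite mxGLM ?groupM ?tv_det ?(det_transvection_product tB) //.
exact: tvK.
Qed.

Lemma SL_trans_col (x y : 'cV[F]_n) : (0 < k)%N -> x != 0 -> y != 0 ->
  exists2 g, g \in SLG F k & GLmx g *m x = y.
Proof.
move=> k0 x0 y0; have [A [/det_transvection_product dA <-]] :=
  @transvection_product_trans F n _ _ k0 x0 y0.
by exists (mxGL A); rewrite ?mxGL_SL // mxGLK.
Qed.

Lemma SL_trans_row (x y : 'rV[F]_n) : (0 < k)%N -> x != 0 -> y != 0 ->
  exists2 g, g \in SLG F k & x *m GLmx g = y.
Proof.
rewrite -trmx_eq0 -(trmx_eq0 y) => k0 x0 y0.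
have [A [/det_transvection_product dA E]] := @transvection_product_trans F n _ _ k0 x0 y0.
exists (mxGL A^T); rewrite ?mxGL_SL ?mxGLK ?det_tr //.
by apply: trmx_inj; rewrite trmx_mul trmxK.
Qed.

(* [1 + c h, 1 + d f] = 1 + (h d) (c f) when the other products vanish. *)
Lemma tvC (c d : 'cV[F]_n) (f h : 'rV[F]_n) a :
  f *m c = 0 -> h *m c = 0 -> f *m d = 0 -> h *m d = a%:M ->
  (tv c h * tv d f = tv (a *: c) f * (tv d f * tv c h))%g.
Proof.
move=> fc hc fd hd; apply: GLmx_inj; rewrite !GLmxM !tvE //; last first.
  by rewrite -scalemxAr fc scaler0.
have E (c1 d1 : 'cV[F]_n) (f1 h1 : 'rV[F]_n) :
  (c1 *m h1) *m (d1 *m f1) = c1 *m (h1 *m d1) *m f1 by rewrite !mulmxA.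
rewrite !(mulmxDl, mulmxDr) !mul1mx !mulmx1 -!scalemxAl !E hd fc fd.
rewrite mul_mx_scalar -!scalemxAl !(mulmx0, mul0mx, scaler0, addr0).
by rewrite addrA [in RHS](addrAC _ (c *m h)).
Qed.

(** By [tvC], the transvection [tv c f] is a commutator: take [d] in the kernel of [f] off the line
    of [c], and [h] killing [c] with value 1 at [d]. *)
Lemma SL_perfect : (1 < k)%N -> [~: SLG F k, SLG F k] = SLG F k.
Proof.
move=> k1; apply/eqP; rewrite eqEsubset commg_subr normG.
apply: SL_generated => c f fc.
have [d [fd dc]] : exists d : 'cV[F]_n, f *m d = 0 /\ ~~ (d^T <= c^T)%MS.
  exact: kernel_notin_line.
have [h [hc hd]] := separating_form 1 dc.
have := tvC fc hc fd hd; rewrite scale1r => E.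
rewrite (commg_of_mul E).
by rewrite mem_commg ?groupV ?tv_SL.
Qed.
End SpecialLinearTransvections.

(** * The parabolic subgroup *)

Section LastRow.
Variables (F : finFieldType) (k : nat).
Let n := k.+1.

(** Written with the same cast as [parabolic_block]. In the proofs below, generalising [addn1 k] and
    destructing it removes all casts at once. *)
Definition last_row : 'rV[F]_n := castmx (erefl 1%N, addn1 k) (row_mx 0 1%:M).

Definition pad_col (x : 'cV[F]_k) : 'cV[F]_n :=
  castmx (addn1 k, erefl 1%N) (col_mx x 0).

Definition pad_row (f : 'rV[F]_k) : 'rV[F]_n :=
  castmx (erefl 1%N, addn1 k) (row_mx f 0).

Lemma last_row_neq0 : last_row != 0.
Proof.
rewrite /last_row /n; move: (addn1 k); case: _ / => /=; rewrite castmx_id.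
by rewrite row_mx_eq0 negb_and oner_eq0 orbT.
Qed.

Lemma last_row_norm : last_row *m last_row^T = 1%:M.
Proof.
rewrite /last_row /n; move: (addn1 k); case: _ / => /=; rewrite castmx_id.
by rewrite tr_row_mx mul_row_col mul0mx add0r trmx1 mulmx1.
Qed.

Lemma last_row_pad x : last_row *m pad_col x = 0.
Proof.
rewrite /last_row /pad_col /n; move: (addn1 k); case: _ / => /=; rewrite !castmx_id.
by rewrite mul_row_col mul0mx mulmx0 addr0.
Qed.

Lemma last_row_ker (c : 'cV[F]_n) : last_row *m c = 0 -> exists x, c = pad_col x.
Proof.
rewrite /last_row /pad_col /n in c *; move: c; move: (addn1 k); case: _ / => /= c.
rewrite castmx_id -[c]vsubmxK mul_row_col mul0mx add0r mul1mx => ->.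
by exists (usubmx c); rewrite castmx_id.
Qed.

Lemma pad_colD x y : pad_col (x + y) = pad_col x + pad_col y.
Proof.
rewrite /pad_col /n; move: (addn1 k); case: _ / => /=; rewrite !castmx_id.
by rewrite add_col_mx addr0.
Qed.

Lemma pad_colZ a x : pad_col (a *: x) = a *: pad_col x.
Proof.
rewrite /pad_col /n; move: (addn1 k); case: _ / => /=; rewrite !castmx_id.
by rewrite scale_col_mx scaler0.
Qed.

Lemma pad_col_eq0 x : (pad_col x == 0) = (x == 0).
Proof.
rewrite /pad_col /n; move: (addn1 k); case: _ / => /=; rewrite !castmx_id.
by rewrite col_mx_eq0 eqxx andbT.
Qed.

Lemma last_row_annihilator (f : 'rV[F]_n) :
  (forall x, f *m pad_col x = 0) -> exists a, f = a *: last_row.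
Proof.
rewrite /last_row /pad_col /n in f *; move: f; move: (addn1 k); case: _ / => /= f f0.
have : lsubmx f = 0.
  apply/row_matrixP=> i; rewrite row0; apply/rowP=> j; rewrite [RHS]mxE !ord1.
  have := f0 (delta_mx j 0); rewrite castmx_id -{1}[f]hsubmxK mul_row_col mulmx0 addr0.
  by rewrite -colE => /colP/(_ 0); rewrite !mxE.
exists (rsubmx f 0 0); rewrite castmx_id -{1}[f]hsubmxK scale_row_mx scaler0 H.
by rewrite scalemx1 -mx11_scalar.
Qed.

Lemma parabolic_block_last_row (B : 'M[F]_k) (x : 'cV_k) b :
  last_row *m (parabolic_block (n := n) B x b) = b *: last_row.
Proof.
rewrite /last_row /parabolic_block /n /=; move: (addn1 k); case: _ / => /=.
rewrite !castmx_id mul_row_block !(mul0mx, add0r, mul1mx, mulmx0) scale_row_mx scaler0.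
by rewrite scalemx1.
Qed.

Lemma pad_row_col f c : pad_row f *m pad_col c = f *m c.
Proof.
rewrite /pad_row /pad_col /n; move: (addn1 k); case: _ / => /=; rewrite !castmx_id.
by rewrite mul_row_col mul0mx addr0.
Qed.

Lemma pad_colM (c : 'cV_k) (A : 'M_1) : pad_col (c *m A) = pad_col c *m A.
Proof. by rewrite [A]mx11_scalar !mul_mx_scalar pad_colZ. Qed.

Lemma pad_row_eq0D f a : (pad_row f + a *: last_row == 0) = (f == 0) && (a == 0).
Proof.
rewrite /pad_row /last_row /n; move: (addn1 k); case: _ / => /=; rewrite !castmx_id.
rewrite scale_row_mx add_row_mx scaler0 addr0 add0r row_mx_eq0.
by rewrite scaler_eq0 oner_eq0 orbF.
Qed.

Lemma parabolic_block_tv (c x : 'cV[F]_k) (f : 'rV_k) :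
  parabolic_block (n := n) (1%:M + c *m f) x 1
  = 1%:M + pad_col c *m pad_row f + pad_col x *m last_row.
Proof.
rewrite /last_row /pad_col /pad_row /parabolic_block /n /=.
move: (addn1 k); case: _ / => /=; rewrite !castmx_id.
rewrite !mul_col_row !(mulmx0, mul0mx, mulmx1) (scalar_mx_block k 1).
by rewrite !add_block_mx !(addr0, add0r).
Qed.

Lemma parabolic_block_unip x :
  parabolic_block (n := n) (1%:M : 'M[F]_k) x 1 = 1%:M + pad_col x *m last_row.
Proof.
rewrite /last_row /pad_col /parabolic_block /n /=; move: (addn1 k); case: _ / => /=.
rewrite !castmx_id mul_col_row !(mulmx0, mul0mx, mulmx1) (scalar_mx_block k 1).
by rewrite add_block_mx !(addr0, add0r).
Qed.

Lemma PGP (g : GLG F k) :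
  reflect (exists B x b, [/\ B \in unitmx, b^-1 = \det B
                           & GLmx g = parabolic_block (n := n) B x b])
          (g \in PG F k).
Proof. exact: (@parabolicP n F g). Qed.

Lemma PG_sub_SLG : PG F k \subset SLG F k.
Proof. exact: (parabolic_sub_SL n F). Qed.

(** This exhibits P as a line stabiliser, the form in which it is used below; the conditions on [B]
    and [b] come from the determinant being 1. *)
Lemma mem_PG (g : GLG F k) :
  reflect (g \in SLG F k /\ exists a, last_row *m GLmx g = a *: last_row)
          (g \in PG F k).
Proof.
apply: (iffP idP) => [Pg|[Sg [a ga]]].
  split; first exact: (subsetP PG_sub_SLG).
  by case/PGP: Pg => B [x [b [_ _ ->]]]; exists b; apply: parabolic_block_last_row.
have [B [x [b gE]]] : exists B x b, GLmx g = parabolic_block (n := n) B x b.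
  move: (GLmx g) ga; rewrite /last_row /parabolic_block /n /=.
  move: (addn1 k); case: _ / => /= A; rewrite !castmx_id.
  rewrite -[A]submxK mul_row_block !mul0mx !add0r !mul1mx scale_row_mx scaler0.
  case/eq_row_mx=> -> _; exists (ulsubmx A), (ursubmx A), (drsubmx A 0 0).
  by rewrite castmx_id -mx11_scalar.
have := SL_det Sg; rewrite gE (@det_parabolic_block n) => Bb.
have b0 : b != 0.
  by apply: contra_eq_neq Bb => ->; rewrite mulr0 eq_sym oner_eq0.
have bB : b^-1 = \det B by apply: (mulIf b0); rewrite Bb mulVf.
apply/PGP; exists B, x, b; split=> //.
by rewrite unitmxE -bB unitrV unitfE.
Qed.
End LastRow.

Section ParabolicIndex.
Variables (F : finFieldType) (k : nat).
Let n := k.+1.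
Let q := #|F|.
Notation delta := (last_row F k).

Definition row_action (v : 'rV[F]_n) (g : GLG F k) : 'rV[F]_n := v *m GLmx g.

Fact row_action1 : row_action^~ 1%g =1 id.
Proof. by move=> v; rewrite /row_action GLmx1 mulmx1. Qed.

Fact row_actionM v : act_morph row_action v.
Proof. by move=> g h; rewrite /row_action GLmxM mulmxA. Qed.

Definition row_act : {action GLG F k &-> 'rV[F]_n} := TotalAction row_action1 row_actionM.

Lemma orbit_last_row_SL : (0 < k)%N ->
  orbit row_act (SLG F k) delta = [set~ 0].
Proof.
move=> k0; apply/setP=> v; rewrite !inE; apply/orbitP/idP => [[g _ <-]|v0].
  apply: contraNneq (last_row_neq0 F k) => g0.
  by rewrite -[delta](actK row_act g) [row_act _ g]g0 /= /row_action mul0mx.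
by have [g Sg gv] := SL_trans_row k0 (last_row_neq0 F k) v0; exists g.
Qed.

Lemma card_nonzero_rows : #|[set~ (0 : 'rV[F]_n)]| = (q ^ n - 1)%N.
Proof. by rewrite cardsC1 card_mx mul1n subn1. Qed.

Lemma orbit_last_row_parabolic : (0 < k)%N ->
  orbit row_act (PG F k) delta = [set a *: delta | a in predC1 (0 : F)].
Proof.
move=> k0; apply/setP=> v; apply/orbitP/imsetP => [[g /mem_PG[Sg [a ga]] <-]|[a a0 ->]].
  exists a => //; rewrite inE; apply: contraNneq (last_row_neq0 F k) => a0.
  by rewrite -[delta](actK row_act g) [row_act _ g]ga a0 scale0r /= /row_action mul0mx.
have [|g Sg ga] := SL_trans_row k0 (last_row_neq0 F k) (y := a *: delta).
  by rewrite scaler_eq0 negb_or last_row_neq0 andbT; rewrite inE in a0.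
by exists g => //; apply/mem_PG; split=> //; exists a.
Qed.

(** Both groups have the same stabiliser of [delta], whose orbit consists of the nonzero rows under
    SL_n and of the nonzero multiples of [delta] under P. *)
Lemma card_SL_parabolic : (0 < k)%N ->
  (#|SLG F k| * (q - 1) = #|PG F k| * (q ^ n - 1))%N.
Proof.
move=> k0; rewrite -(card_orbit_stab row_act (SLG F k) delta).
rewrite -(card_orbit_stab row_act (PG F k) delta).
rewrite /= orbit_last_row_SL // orbit_last_row_parabolic // card_nonzero_rows.
rewrite card_imset; last first.
  move=> a b /eqP; rewrite -subr_eq0 -scalerBl scaler_eq0 subr_eq0.
  by rewrite (negPf (last_row_neq0 F k)) orbF => /eqP.
rewrite cardC1 -subn1.
suff -> : 'C_(SLG F k)[delta | row_act] = 'C_(PG F k)[delta | row_act].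
  by rewrite mulnC mulnA [RHS]mulnAC.
apply/setP=> g; rewrite in_setI [RHS]in_setI; apply: andb_id2r => Cg; have gd := astab1P Cg.
apply/idP/idP => [Sg|/(subsetP (PG_sub_SLG F k))//].
by apply/mem_PG; split=> //; exists 1; rewrite scale1r.
Qed.

Lemma index_parabolic : (0 < k)%N ->
  (#|SLG F k : PG F k| * (q - 1) = q ^ n - 1)%N.
Proof.
move=> k0; have := card_SL_parabolic k0.
rewrite -(Lagrange (PG_sub_SLG F k)) -mulnA => /eqP.
by rewrite eqn_pmul2l ?cardG_gt0 // => /eqP.
Qed.
End ParabolicIndex.

(** * The inverse transpose automorphism, which exchanges axes and centers of transvections *)

Section InverseTranspose.
Variables (F : finFieldType) (k : nat).
Let n := k.+1.

Definition invtrGL (g : GLG F k) : GLG F k := mxGL (GLmx g^-1%g)^T.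

Lemma invtrGLE g : GLmx (invtrGL g) = (GLmx g^-1%g)^T.
Proof. by rewrite mxGL_unit // unitmx_tr GLmx_unit. Qed.

Lemma invtrGLM : {morph invtrGL : g h / (g * h)%g}.
Proof.
move=> g h; apply: GLmx_inj.
by rewrite GLmxM !invtrGLE invMg GLmxM trmx_mul.
Qed.

Lemma invtrGL1 : invtrGL 1%g = 1%g.
Proof. by apply: GLmx_inj; rewrite invtrGLE invg1 GLmx1 trmx1. Qed.

Lemma invtrGLV g : invtrGL g^-1%g = (invtrGL g)^-1%g.
Proof. by apply/eqP; rewrite eq_sym eq_invg_mul -invtrGLM mulgV invtrGL1. Qed.

Lemma invtrGLK : involutive invtrGL.
Proof.
by move=> g; apply: GLmx_inj; rewrite invtrGLE -invtrGLV invtrGLE trmxK invgK.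
Qed.

Lemma invtrGLJ g h : invtrGL (g ^ h)%g = (invtrGL g ^ invtrGL h)%g.
Proof. by rewrite /conjg !invtrGLM invtrGLV. Qed.

Lemma invtrGL_SL g : (invtrGL g \in SLG F k) = (g \in SLG F k).
Proof.
by rewrite -[RHS]groupV !mem_SLG invtrGLE det_tr.
Qed.

Lemma invtrGL_tv (c : 'cV[F]_n) (f : 'rV[F]_n) : f *m c = 0 ->
  invtrGL (tv c f) = tv f^T (- c^T).
Proof.
move=> fc; have fc' : - c^T *m f^T = 0 by rewrite mulNmx -trmx_mul fc trmx0 oppr0.
suff E : (tv c f)^-1%g = tv c (- f).
  apply: GLmx_inj; rewrite invtrGLE E !tvE ?mulNmx ?fc ?oppr0 //.
    by rewrite linearD /= trmx1 trmx_mul linearN /= mulNmx mulmxN.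
  by rewrite -mulNmx.
apply/eqP; rewrite eq_invg_mul; apply/eqP/GLmx_inj.
rewrite GLmxM !tvE ?mulNmx ?fc ?oppr0 // GLmx1 mulmxN mulmxBr mulmx1.
by rewrite mulmxDl mul1mx -mulmxA [f *m (c *m f)]mulmxA fc mul0mx mulmx0 addr0 addrK.
Qed.
End InverseTranspose.

(** * Root groups: transvections with a given axis or center *)

Section RootSubgroups.
Variables (F : finFieldType) (k : nat).
Let n := k.+1.
Notation delta := (last_row F k).

Definition col_root (x : 'cV[F]_k) : GLG F k := tv (pad_col x) delta.

Lemma col_rootE x : GLmx (col_root x) = 1%:M + pad_col x *m delta.
Proof. by rewrite tvE ?last_row_pad. Qed.

Lemma col_rootD : {morph col_root : x y / x + y >-> (x * y)%g}.
Proof.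
move=> x y; apply: GLmx_inj; rewrite GLmxM !col_rootE pad_colD.
rewrite !(mulmxDl, mulmxDr) !mul1mx !mulmx1 -mulmxA [delta *m _]mulmxA.
by rewrite last_row_pad mul0mx mulmx0 addr0 -addrA [_ *m _ + _]addrC addrA addrAC.
Qed.

Lemma col_root_inj : injective col_root.
Proof.
suff col_root0 x : col_root x = 1%g -> x = 0.
  move=> x y E; apply/eqP; rewrite -subr_eq0; apply/eqP/col_root0.
  apply: (mulIg (col_root y)); by rewrite -col_rootD subrK E mul1g.
move/(congr1 (@GLmx F k)); rewrite col_rootE GLmx1 => /eqP.
rewrite addrC -subr_eq0 addrK => /eqP E; apply/eqP; rewrite -pad_col_eq0; apply/eqP.
have /rV0Pn[j dj] := last_row_neq0 F k.
apply/colP=> i; have /matrixP/(_ i j) := E; rewrite !mxE big_ord1 => /eqP.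
by rewrite mulf_eq0 (negPf dj) orbF => /eqP.
Qed.

Lemma col_root_SL x : col_root x \in SLG F k.
Proof. by rewrite tv_SL ?last_row_pad. Qed.

Lemma col_root_tv (w : 'cV_k) (f : 'rV_k) : f *m w = 0 ->
  exists2 g, g \in SLG F k & forall x, (col_root x ^ g)%g = col_root (x + w *m (f *m x)).
Proof.
move=> fw; have fw' : pad_row f *m pad_col w = 0 by rewrite pad_row_col.
pose t := tv (pad_col w) (pad_row f).
have dt : delta *m GLmx t = delta.
  by rewrite tvE // mulmxDr mulmx1 mulmxA last_row_pad mul0mx addr0.
exists t^-1%g => [|x]; first by rewrite groupV tv_SL.
rewrite tvJ ?last_row_pad // invgK.
have -> : delta *m GLmx t^-1%g = delta.
  by rewrite -{1}dt -mulmxA GLmx_mulV mulmx1.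
by rewrite tvE // mulmxDl mul1mx -mulmxA pad_row_col -pad_colM -pad_colD.
Qed.

Lemma col_root_parabolic g x : g \in PG F k ->
  exists y, (col_root x ^ g)%g = col_root y.
Proof.
move=> Pg; have /mem_PG[_ [a ga]] := Pg.
have /mem_PG[_ [b gb]] := groupVr Pg.
have [|y yE] := last_row_ker (c := a *: (GLmx g^-1%g *m pad_col x)).
  by rewrite -scalemxAr mulmxA gb -scalemxAl last_row_pad !scaler0.
exists y; apply: GLmx_inj; rewrite col_rootE -yE tvJ ?last_row_pad // ga.
rewrite tvE; first by rewrite -scalemxAr scalemxAl.
by rewrite -scalemxAl mulmxA gb -scalemxAl last_row_pad !scaler0.
Qed.

(** These transvections have center [delta^T]; as images of [col_root] under inverse transpose they
    inherit its properties. *)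
Definition row_root (x : 'cV[F]_k) : GLG F k := invtrGL (col_root x).

Lemma row_rootD : {morph row_root : x y / x + y >-> (x * y)%g}.
Proof. by move=> x y; rewrite /row_root col_rootD invtrGLM. Qed.

Lemma row_root_inj : injective row_root.
Proof. exact: inj_comp (inv_inj (@invtrGLK F k)) col_root_inj. Qed.

Lemma row_root_SL x : row_root x \in SLG F k.
Proof. by rewrite invtrGL_SL col_root_SL. Qed.

Lemma row_root_tv (w : 'cV_k) (f : 'rV_k) : f *m w = 0 ->
  exists2 g, g \in SLG F k & forall x, (row_root x ^ g)%g = row_root (x + w *m (f *m x)).
Proof.
case/col_root_tv=> g Sg gE; exists (invtrGL g) => [|x]; first by rewrite invtrGL_SL.
by rewrite -invtrGLJ gE.
Qed.

(** A single [g] sending [delta] to [f] conjugates the root group onto the transvections with axis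
    the kernel of [f]. *)
Lemma tv_col_root (f : 'rV[F]_n) : (0 < k)%N -> f != 0 ->
  exists2 g, g \in SLG F k & forall c : 'cV_n, f *m c = 0 ->
    exists x, tv c f = (col_root x ^ g)%g /\ (x = 0 -> c = 0).
Proof.
move=> k0 f0; have [g Sg gE] := SL_trans_row k0 (last_row_neq0 F k) f0.
exists g => // c fc; have [|x xE] := last_row_ker (c := GLmx g *m c).
  by rewrite mulmxA gE.
have cE : c = GLmx g^-1%g *m pad_col x.
  by rewrite -xE mulmxA GLmx_Vmul mul1mx.
exists x; rewrite tvJ ?last_row_pad // gE -cE; split=> // x0.
by rewrite cE (eqP (_ : pad_col x == 0)) ?mulmx0 // pad_col_eq0 x0.
Qed.

Lemma tv_row_root (c : 'cV[F]_n) : (0 < k)%N -> c != 0 ->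
  exists2 g, g \in SLG F k & forall f : 'rV_n, f *m c = 0 ->
    exists x, tv c f = (row_root x ^ g)%g /\ (x = 0 -> f = 0).
Proof.
move=> k0; rewrite -trmx_eq0 => /(tv_col_root k0)[g Sg gE].
exists (invtrGL g) => [|f fc]; first by rewrite invtrGL_SL.
have fc' : c^T *m - f^T = 0 by rewrite mulmxN -trmx_mul fc trmx0 oppr0.
have [x [xE x0]] := gE _ fc'; exists x; rewrite -invtrGLJ -xE invtrGL_tv // trmxK.
rewrite linearN /= trmxK opprK; split=> // /x0/eqP.
by rewrite oppr_eq0 trmx_eq0 => /eqP.
Qed.
End RootSubgroups.

(** * Transitive actions of small degree *)

Section MinimalDegree.
Variables (F : finFieldType) (k : nat) (T : finType).
Let n := k.+1.
Variables (to : {action GLG F k &-> T}) (S : {set T}).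
Hypothesis k_gt2 : (2 < k)%N.
Hypothesis trS : [transitive SLG F k, on S | to].
Hypothesis S_gt1 : (1 < #|S|)%N.
Hypothesis S_lt : (#|S| * (#|F| - 1) < #|F| ^ n - 1)%N.
Notation delta := (last_row F k).
Let N := (#|F| ^ k)%N.

Let k_gt1 : (1 < k)%N. Proof. exact: ltnW. Qed.
Let k_gt0 : (0 < k)%N. Proof. exact: ltnW. Qed.

Let q_gt1 : (1 < #|F|)%N. Proof. exact: card_finRing_gt1. Qed.

Let N_gt0 : (0 < N)%N. Proof. by rewrite expn_gt0 (ltnW q_gt1). Qed.

Let qN : (#|F| ^ n = #|F| * N)%N. Proof. by rewrite expnS. Qed.

Let S_small : (#|S| < 2 * #|F| ^ k)%N.
Proof.
have arith m q M : (m * (q - 1) < q * M - 1 -> 1 < q -> m < 2 * M)%N.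
  case: q => // q; rewrite subn1 /= ltnS => lt_m q0; rewrite ltnNge; apply/negP=> le_m.
  have := leq_mul le_m (leqnn q); have : (M <= M * q)%N by rewrite leq_pmulr.
  by move: lt_m; clear; nia.
by apply: arith q_gt1; rewrite -qN.
Qed.

(** Since [#|F| - 1] divides [N - 1], the number [d - 1 = q (N - 1) / (q - 1)] is an integer, so
    [#|S| < d] gives [#|S| <= d - 1]. *)
Let S_le : (#|S| * (#|F| - 1) <= #|F| * (N - 1))%N.
Proof.
have NE : (N - 1 = (#|F| - 1) * \sum_(i < k) #|F| ^ i)%N.
  by rewrite !subn1 predn_exp.
have arith m q b : (m * (q - 1) < q * ((q - 1) * b).+1 - 1 -> 1 < q ->
  m * (q - 1) <= q * ((q - 1) * b))%N.
  case: q => // q; rewrite subn1 /= ltnS mulnCA [(m * q)%N]mulnC => lt_m q0.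
  rewrite leq_pmul2l // -ltnS -(ltn_pmul2l q0); move: lt_m; clear; nia.
have NK : (N - 1).+1 = N by rewrite subn1 prednK.
by rewrite NE; apply: arith q_gt1; rewrite -NE NK -qN.
Qed.

Let actsG : [acts SLG F k, on S | to]. Proof. exact: atrans_acts. Qed.

Let toS g s : g \in SLG F k -> s \in S -> to s g \in S.
Proof. by move=> Gg; rewrite (acts_act actsG). Qed.

Let tv_fix_trivial s : s \in S ->
  (forall (c : 'cV_n) (f : 'rV_n), f *m c = 0 -> to s (tv c f) = s) -> False.
Proof.
move=> Ss fix_s; have /subsetP sub : SLG F k \subset 'C_(SLG F k)[s | to].
  rewrite subsetI subxx; apply: (@SL_generated _ _ 'C[s | to]%G) => c f fc.
  by apply/astab1P/fix_s.
have : orbit to (SLG F k) s = [set s].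
  apply/setP=> t; rewrite inE; apply/orbitP/eqP => [[g /sub/setIP[_ /astab1P gs] <-]|->].
    by rewrite gs.
  by exists 1%g; rewrite ?act1 ?group1.
by rewrite (atransP trS _ Ss) => E; move: S_gt1; rewrite E cards1.
Qed.

Let moved : exists c f s, [/\ f *m c = 0, s \in S & to s (tv c f) != s].
Proof.
have /set0Pn[s0 Ss0] : S != set0 by rewrite -card_gt0 ltnW.
have [/existsP[c /existsP[f /andP[/eqP fc ne]]]|] :=
  boolP [exists c : 'cV[F]_n, exists f : 'rV[F]_n, (f *m c == 0) && (to s0 (tv c f) != s0)].
  by exists c, f, s0.
rewrite negb_exists => /forallP all_fix; case: (tv_fix_trivial Ss0) => c f fc.
have := all_fix c; rewrite negb_exists => /forallP/(_ f).
by rewrite fc eqxx /= negbK => /eqP.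
Qed.

Let tv_degenerate s (c : 'cV[F]_n) (f : 'rV[F]_n) :
  c = 0 \/ f = 0 -> to s (tv c f) = s.
Proof.
suff E : c = 0 \/ f = 0 -> tv c f = 1%g by move=> /E->; rewrite act1.
move=> cf; have cf0 : c *m f = 0 by case: cf => ->; rewrite ?mul0mx ?mulmx0.
have fc0 : f *m c = 0 by case: cf => ->; rewrite ?mul0mx ?mulmx0.
by apply: GLmx_inj; rewrite tvE // cf0 addr0 GLmx1.
Qed.

Let col_moved : exists x s, s \in S /\ to s (col_root x) != s.
Proof.
have [c [f [s [fc Ss ne]]]] := moved.
have f0 : f != 0 by apply: contraNneq ne => f0; rewrite tv_degenerate //; right.
have [g Sg /(_ c fc)[x [E _]]] := tv_col_root k_gt0 f0.
exists x, (to s g^-1%g); rewrite -act_conj_fix -E; split=> //.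
by rewrite toS ?groupV.
Qed.

Let row_moved : exists x s, s \in S /\ to s (row_root x) != s.
Proof.
have [c [f [s [fc Ss ne]]]] := moved.
have c0 : c != 0 by apply: contraNneq ne => c0; rewrite tv_degenerate //; left.
have [g Sg /(_ f fc)[x [E _]]] := tv_row_root k_gt0 c0.
exists x, (to s g^-1%g); rewrite -act_conj_fix -E; split=> //.
by rewrite toS ?groupV.
Qed.

(** * Fewer than [d - 1] points *)

Section Subcritical.
Hypothesis S_sub : (#|S| * (#|F| - 1) < #|F| * (N - 1))%N.

Let tv_fix_col s (c d : 'cV_n) (f : 'rV_n) : s \in S ->
  f *m c = 0 -> f *m d = 0 -> c != 0 -> to s (tv c f) = s -> to s (tv d f) = s.
Proof.
move=> Ss fc fd c0 /eqP cs.
have [->|f0] := eqVneq f 0; first by apply: tv_degenerate; right.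
have [g Sg gE] := tv_col_root k_gt0 f0.
have [x [xE x0]] := gE c fc; have [y [yE _]] := gE d fd.
move: cs; rewrite xE yE => cs; apply/eqP; move: cs; rewrite !act_conj_fix.
have [x1 [s1 [Ss1 ne1]]] := col_moved.
move=> cs; apply: (stab_vec_all_or_none k_gt1 trS (@col_rootD F k) (@col_root_inj F k)
  (@col_root_SL F k) (@col_root_tv F k) S_small Ss1 ne1 _ S_sub _ _ cs).
  by rewrite toS ?groupV.
by apply: contraNneq c0 => /x0->.
Qed.

Let tv_fix_row s (c : 'cV_n) (f h : 'rV_n) : s \in S ->
  f *m c = 0 -> h *m c = 0 -> f != 0 -> to s (tv c f) = s -> to s (tv c h) = s.
Proof.
move=> Ss fc hc f0 /eqP fs.
have [->|c0] := eqVneq c 0; first by apply: tv_degenerate; left.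
have [g Sg gE] := tv_row_root k_gt0 c0.
have [x [xE x0]] := gE f fc; have [y [yE _]] := gE h hc.
move: fs; rewrite xE yE => fs; apply/eqP; move: fs; rewrite !act_conj_fix.
have [x1 [s1 [Ss1 ne1]]] := row_moved.
move=> fs; apply: (stab_vec_all_or_none k_gt1 trS (@row_rootD F k) (@row_root_inj F k)
  (@row_root_SL F k) (@row_root_tv F k) S_small Ss1 ne1 _ S_sub _ _ fs).
  by rewrite toS ?groupV.
by apply: contraNneq f0 => /x0->.
Qed.

(* Any two transvections (c, f) and (d, h) are linked by (e, f) and (e, h) with
   e in the kernels of f and h, so a point fixed by one of them is fixed by all. *)
Let tv_no_fix s (c : 'cV_n) (f : 'rV_n) : s \in S ->
  f *m c = 0 -> c != 0 -> f != 0 -> to s (tv c f) = s -> False.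
Proof.
move=> Ss fc c0 f0 fs; apply: (tv_fix_trivial Ss) => d h hd.
have [|e [fhe e0]] := @kernel_notin_line F _ _ (col_mx f h) 0 _; first exact: k_gt2.
have {}e0 : e != 0 by apply: contraNneq e0 => ->; apply: submx_refl.
move: fhe; rewrite mul_col_mx => /eqP; rewrite col_mx_eq0 => /andP[/eqP fe /eqP he].
apply: (tv_fix_col Ss he hd e0); apply: (tv_fix_row Ss fe he f0).
exact: (tv_fix_col Ss fc fe c0).
Qed.

Let M (B : 'M[F]_k) (y : 'cV_k) := mxGL (parabolic_block (n := n) B y 1).

Let detM (B : 'M[F]_k) y : \det B = 1 -> \det (parabolic_block (n := n) B y 1) = 1.
Proof. by move=> dB; rewrite det_parabolic_block dB mulr1. Qed.

Let MM B C y z : \det B = 1 -> \det C = 1 -> (M B y * M C z)%g = M (B *m C) (B *m z + y).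
Proof.
move=> dB dC; rewrite /M -mxGLM ?detM //.
by rewrite (@parabolic_blockM n) scale1r mulr1.
Qed.

Let M_col_root x : M 1%:M x = col_root x.
Proof. by apply: GLmx_inj; rewrite col_rootE mxGLK ?detM ?det1 // parabolic_block_unip. Qed.

Let col_root0 : col_root (0 : 'cV[F]_k) = 1%g.
Proof. by apply: (mulgI (col_root (0 : 'cV[F]_k))); rewrite -col_rootD addr0 mulg1. Qed.

Let col_root_free s x : s \in S -> to s (col_root x) = s -> x = 0.
Proof.
move=> Ss xs; apply/eqP; apply: contraT => x0; exfalso.
by apply: (tv_no_fix Ss _ _ _ xs); rewrite ?last_row_pad ?pad_col_eq0 ?last_row_neq0.
Qed.

Variable s : T.
Hypothesis Ss : s \in S.

(** As no nontrivial transvection has a fixed point, the root group is regular on [S], and one of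
    its elements corrects [M B 0]. *)
Let lift (B : 'M_k) : \det B = 1 -> exists y, to s (M B y) = s.
Proof.
move=> dB; have [x1 [s1 [Ss1 ne1]]] := col_moved.
have [|||x xE] := transvection_module_orbit k_gt1 trS (@col_rootD F k)
  (@col_root_inj F k) (@col_root_SL F k) (@col_root_tv F k) S_small Ss1 ne1 Ss
  _ _ (t := to s (M B 0)).
- by move=> x /stab_vecP; apply: col_root_free.
- apply/eqP; rewrite cards_eq0; apply/eqP/setP=> t; rewrite in_set0.
  apply/negP=> /setIP[St /afix1P ts]; move: ne1.
  by rewrite (col_root_free St ts) col_root0 act1 eqxx.
- by apply: toS => //; rewrite mxGL_SL ?detM.
exists (- (B *m x)).
have -> : M B (- (B *m x)) = (M B 0 * M 1%:M (- x))%g.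
  by rewrite MM ?det1 // mulmx1 mulmxN addr0.
by rewrite M_col_root actM xE -actM -col_rootD subrr col_root0 act1.
Qed.

(** Two lifts of [B] fixing [s] differ by an element of the root group fixing [s]. *)
Let lift_inj (B : 'M_k) y z : \det B = 1 ->
  to s (M B y) = s -> to s (M B z) = s -> y = z.
Proof.
move=> dB ys zs; have uB : B \in unitmx by rewrite unitmxE dB unitr1.
have E : M B y = (M B z * M 1%:M (invmx B *m (y - z)))%g.
  by rewrite MM ?det1 // mulmx1 mulKVmx // subrK.
have : invmx B *m (y - z) = 0.
  by apply: (col_root_free Ss); rewrite -M_col_root -{1}zs -actM -E.
move/(congr1 (mulmx B)); rewrite mulKVmx // mulmx0 => /eqP.
by rewrite subr_eq0 => /eqP.
Qed.

(** The products of the two lifts in either order fix [s] and lift the same matrix, so they agree by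
    [lift_inj]; their last columns are compared. *)
Let tv_commute (c d y z : 'cV_k) (f h : 'rV_k) :
  f *m c = 0 -> h *m d = 0 -> f *m d = 0 -> h *m c = 0 ->
  to s (M (1%:M + c *m f) y) = s -> to s (M (1%:M + d *m h) z) = s ->
  c *m (f *m z) = d *m (h *m y).
Proof.
move=> fc hd fd hc ys zs.
have dB : \det (1%:M + c *m f) = 1 by rewrite det_1Dcolrow fc mxE addr0.
have dC : \det (1%:M + d *m h) = 1 by rewrite det_1Dcolrow hd mxE addr0.
have BC : (1%:M + c *m f) *m (1%:M + d *m h) = (1%:M + d *m h) *m (1%:M + c *m f).
  rewrite !(mulmxDl, mulmxDr) !mul1mx !mulmx1 -!mulmxA [f *m (d *m _)]mulmxA fd.
  by rewrite [h *m (c *m _)]mulmxA hc !mul0mx !mulmx0 !addr0 addrAC.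
have dBC : \det ((1%:M + c *m f) *m (1%:M + d *m h)) = 1 by rewrite det_mulmx dB dC mulr1.
have := @lift_inj _ ((1%:M + c *m f) *m z + y) ((1%:M + d *m h) *m y + z) dBC.
rewrite -MM // {1}BC -MM // !actM ys zs ys => /(_ erefl erefl).
rewrite !mulmxDl !mul1mx -!mulmxA [RHS]addrAC [in LHS]addrAC [z + y]addrC.
by move/addrI.
Qed.

Hypothesis two_neq0 : (2%:R : F) != 0.

Lemma subcritical_False : False.
Proof.
have [c c0] : exists c : 'cV[F]_k, c != 0.
  have [x xn] := @notin_rowspace F 1 k 0 k_gt1; exists x.
  by apply: contraNneq xn => ->; rewrite trmx0 sub0mx.
(* For a fixed center [c], [Z] relates [f] to the column [y] of the lift of [1 + c f]. The aim is to
   find [y] on the line of [c], which makes this lift a transvection. *)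
pose Z (f : 'rV[F]_k) y := f *m c = 0 /\ to s (M (1%:M + c *m f) y) = s.
(* Compare with the lift of [1 + d f], for [d] in the kernel of [f] off the line of [c]. *)
have Z_ker f y : Z f y -> f *m y = 0.
  case=> fc ys; have [d [fd dc]] := @kernel_notin_line F _ _ f c k_gt2.
  have [|z zs] := lift (B := 1%:M + d *m f).
    by rewrite det_1Dcolrow fd mxE addr0.
  have := tv_commute fc fd fd fc ys zs.
  rewrite [f *m z]mx11_scalar [f *m y]mx11_scalar !mul_mx_scalar => E.
  have [-> |b0] := eqVneq ((f *m y) 0 0) 0; first exact: raddf0.
  case/negP: dc; have -> : d = (((f *m y) 0 0)^-1 * (f *m z) 0 0) *: c.
    by rewrite -scalerA E scalerA mulVf // scale1r.
  by rewrite linearZ scalemx_sub.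
have Z_sym f h y z : Z f y -> Z h z -> f *m z = h *m y.
  move=> [fc ys] [hc zs]; have := tv_commute fc hc fc hc ys zs.
  rewrite [f *m z]mx11_scalar [h *m y]mx11_scalar !mul_mx_scalar => /eqP.
  rewrite -subr_eq0 -scalerBl scaler_eq0 (negPf c0) orbF subr_eq0.
  by move=> /eqP->.
have Z_add f h y z : Z f y -> Z h z -> Z (f + h) ((1%:M + c *m f) *m z + y).
  move=> [fc ys] [hc zs]; split; first by rewrite mulmxDl fc hc addr0.
  have -> : 1%:M + c *m (f + h) = (1%:M + c *m f) *m (1%:M + c *m h).
    rewrite mulmxDr !(mulmxDl, mulmxDr) !mul1mx mulmx1 -!mulmxA [f *m (c *m _)]mulmxA fc.
    by rewrite mul0mx mulmx0 addr0 addrA.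
  by rewrite -MM ?actM ?ys ?det_1Dcolrow ?fc ?hc ?mxE ?addr0.
have [f [fc f0]] : exists f : 'rV[F]_k, f *m c = 0 /\ f != 0.
  have [x xn] := @notin_rowspace F 1 k c^T k_gt1.
  have [f [fc fx]] := separating_form 1 xn; exists f; split=> //.
  apply: contra_eq_neq fx => ->; rewrite mul0mx eq_sym; apply/eqP=> /matrixP/(_ 0 0).
  by rewrite !mxE => /eqP; rewrite oner_eq0.
have [|y ys] := lift (B := 1%:M + c *m f); first by rewrite det_1Dcolrow fc mxE addr0.
have Zf : Z f y by [].
have y_ker (h : 'rV[F]_k) : h *m c = 0 -> h *m y = 0.
  move=> hc; have [|z zs] := lift (B := 1%:M + c *m h).
    by rewrite det_1Dcolrow hc mxE addr0.
  have Zh : Z h z by [].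
  (* The column of the lift for [f + h] is killed by [f + h], which by [Z_sym] reads [2 (h y) = 0]:
     here the oddness of [q] enters. *)
  have := Z_ker _ _ (Z_add _ _ _ _ Zf Zh).
  rewrite !(mulmxDl, mulmxDr) !mul1mx !mulmxA fc hc !mul0mx (Z_ker _ _ Zf) (Z_ker _ _ Zh).
  rewrite (Z_sym _ _ _ _ Zf Zh) !(addr0, add0r) -mulr2n -scaler_nat => /eqP.
  by rewrite scaler_eq0 (negPf two_neq0) => /eqP.
have /sub_rVP[a ya] : (y^T <= c^T)%MS.
  apply: contraT => /(separating_form 1)[h [hc hy]].
  have := y_ker h hc; rewrite hy => /matrixP/(_ 0 0); rewrite !mxE => /eqP.
  by rewrite oner_eq0.
have {ya}yE : y = a *: c by apply: trmx_inj; rewrite ya linearZ.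
apply: (@tv_no_fix s (pad_col c) (pad_row f + a *: delta) Ss).
- by rewrite mulmxDl pad_row_col fc -scalemxAl last_row_pad scaler0 addr0.
- by rewrite pad_col_eq0.
- by rewrite pad_row_eq0D negb_and f0.
rewrite -{2}ys; congr (to s _); apply: GLmx_inj.
have fc' : (pad_row f + a *: delta) *m pad_col c = 0.
  by rewrite mulmxDl pad_row_col fc -scalemxAl last_row_pad scaler0 addr0.
rewrite tvE // mxGLK ?detM ?det_1Dcolrow ?fc ?mxE ?addr0 //.
by rewrite parabolic_block_tv yE pad_colZ mulmxDr -addrA -scalemxAl -scalemxAr.
Qed.
End Subcritical.

(** * Exactly [d - 1] points *)

Section Critical.
Hypothesis S_crit : (#|S| * (#|F| - 1) = #|F| * (N - 1))%N.

Let N_lt_S : (N < #|S|)%N.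
Proof.
have qN' : (#|F| < N)%N by rewrite -{1}[#|F|]expn1 ltn_exp2l.
move: S_crit; have arith m q M : (1 < q -> q < M -> m * (q - 1) = q * (M - 1) -> M < m)%N.
  case: q => // q; case: M => // M; rewrite !subn1 /= ltnS => q0 qM E.
  by rewrite -(ltn_pmul2r q0) E; move: qM; clear; nia.
exact: arith q_gt1 qN'.
Qed.

(** The index of [X] is that of P, namely [d = #|S| + 1]. The statement covers the inverse transpose
    of P as well as P. *)
Let coprime_index (X : {group GLG F k}) : X \subset SLG F k ->
  #|X| = #|PG F k| -> [transitive X, on S | to].
Proof.
move=> sX cardX; apply: (coprime_index_transitive trS sX).
have P_index : #|SLG F k : PG F k| = #|S|.+1.
  have q1 : (0 < #|F| - 1)%N by rewrite subn_gt0.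
  apply/eqP; rewrite -(eqn_pmul2r q1); apply/eqP.
  apply: etrans (@index_parabolic F k k_gt0) _.
  rewrite qN mulSn S_crit; move: q_gt1 N_gt0; clear; case: #|F| => // q; case: N => // M.
  rewrite !subn1 /=; nia.
rewrite (eq_card_index sX (PG_sub_SLG F k) cardX) P_index.
exact: coprimenS.
Qed.

Let col_stab t : t \in S -> exists2 x, x != 0 & x \in stab_vec to (@col_root F k) t.
Proof.
move=> St; have [x1 [s1 [Ss1 ne1]]] := col_moved.
apply: (stab_vec_nontrivial k_gt1 trS (@col_rootD F k) (@col_root_inj F k)
  (@col_root_SL F k) (@col_root_tv F k) S_small Ss1 ne1 (X := PG F k)) => //.
  by apply: coprime_index => //; apply: parabolic_sub_SL.
by move=> g x; apply: col_root_parabolic.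
Qed.

Let row_stab t : t \in S -> exists2 x, x != 0 & x \in stab_vec to (@row_root F k) t.
Proof.
move=> St; have [x1 [s1 [Ss1 ne1]]] := row_moved.
pose tau := Morphism (in2W (@invtrGLM F k) : {in [set: _] &, {morph _ : _ _ / _}}).
(* The inverse transpose of P normalises the group of all [row_root x]. *)
pose X := (tau @* PG F k)%G.
have XP g : g \in X -> invtrGL g \in PG F k.
  by case/morphimP=> h _ Ph ->; rewrite /= invtrGLK.
apply: (stab_vec_nontrivial k_gt1 trS (@row_rootD F k) (@row_root_inj F k)
  (@row_root_SL F k) (@row_root_tv F k) S_small Ss1 ne1 (X := X)) => //.
  apply: coprime_index.
    apply/subsetP=> g /XP /(subsetP (PG_sub_SLG F k)).
    by rewrite invtrGL_SL.
  apply: card_injm; last exact: subsetT.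
  by apply/injmP=> g h _ _; apply: (inv_inj (@invtrGLK F k)).
move=> g x /XP Pg; have [y yE] := col_root_parabolic x Pg; exists y.
by rewrite /row_root -yE invtrGLJ invtrGLK.
Qed.

(* R, the set of x with 1 + x delta fixing s, is complemented by the line of w.
   A transvection t = 1 + c f fixing s with center c = pad_col w satisfies
   [t, 1 + x delta] = 1 + f(x) c delta, so f vanishes on R, hence f is a multiple
   of delta and t = 1 + a w delta, against the choice of w. *)
Lemma critical_False : False.
Proof.
have [w [s [Ss ne]]] := col_moved.
have wR : w \notin stab_vec to (@col_root F k) s by rewrite inE.
have [span indep] := stab_vec_complement k_gt1 trS (@col_rootD F k) (@col_root_inj F k)
  (@col_root_SL F k) (@col_root_tv F k) S_small Ss ne k_gt2 S_crit col_stab Ss wR.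
have w0 : w != 0.
  by apply: contraNneq wR => ->; apply: (stab_vec0 to (@col_rootD F k)).
(* With [g] carrying the center [delta^T] to [pad_col w], a row transvection fixing [to s g] is
   conjugate to a transvection with center [pad_col w] fixing [s]. *)
have [f [f0 fc fs]] : exists f : 'rV_n,
    [/\ f != 0, f *m pad_col w = 0 & to s (tv (pad_col w) f) = s].
  have c0 : pad_col w != 0 by rewrite pad_col_eq0.
  have d0 : delta^T != 0 by rewrite trmx_eq0 last_row_neq0.
  have [g Sg gE] := SL_trans_col k_gt0 d0 c0.
  have [x x0 /stab_vecP xs] := row_stab (toS Sg Ss).
  have dx0 : - (pad_col x)^T *m delta^T = 0.
    by rewrite mulNmx -trmx_mul last_row_pad trmx0 oppr0.
  exists (- (pad_col x)^T *m GLmx g^-1%g); split.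
  - apply: contraNneq x0 => /(congr1 (mulmx^~ (GLmx g))).
    rewrite -mulmxA GLmx_Vmul mulmx1 mul0mx => /eqP.
    by rewrite oppr_eq0 trmx_eq0 pad_col_eq0.
  - by rewrite -gE mulmxA -[_ *m _ *m GLmx g]mulmxA GLmx_Vmul mulmx1.
  have -> : tv (pad_col w) (- (pad_col x)^T *m GLmx g^-1%g) = (row_root x ^ g^-1)%g.
    by rewrite /row_root /col_root invtrGL_tv ?last_row_pad // tvJ // invgK gE.
  by apply/eqP; rewrite act_conj_fix invgK xs.
have f_pad x : f *m pad_col x = 0.
  suff f_stab y : y \in stab_vec to (@col_root F k) s -> f *m pad_col y = 0.
    have [a /f_stab] := span x; rewrite -scaleNr pad_colD pad_colZ mulmxDr -scalemxAr.
    by rewrite fc scaler0 addr0.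
  move/stab_vecP=> ys; pose a := (f *m pad_col y) 0 0.
  suff a0 : a = 0 by rewrite [f *m _]mx11_scalar -/a a0 raddf0.
  apply: indep; apply/stab_vecP.
  have E : (tv (pad_col w) f * col_root y =
            col_root (a *: w) * (col_root y * tv (pad_col w) f))%g.
    rewrite /col_root pad_colZ; apply: tvC; rewrite ?last_row_pad //.
    exact: mx11_scalar.
  apply: (act_inj to (col_root y)); apply: (act_inj to (tv (pad_col w) f)).
  by rewrite /= ys fs -!actM -E actM fs ys.
have [a fE] := last_row_annihilator f_pad.
have a0 : a != 0 by apply: contraNneq f0 => a0; rewrite fE a0 scale0r.
case/eqP: a0; apply: indep; apply/stab_vecP.
by rewrite /col_root pad_colZ -[RHS]fs fE /tv -scalemxAl -scalemxAr.
Qed.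
End Critical.

Lemma small_action_False : (2%:R : F) != 0 -> False.
Proof.
move=> two_neq0; move: S_le; rewrite leq_eqVlt => /orP[/eqP|lt_S].
  exact: critical_False.
have /set0Pn[s Ss] : S != set0 by rewrite -card_gt0 ltnW.
exact: subcritical_False Ss two_neq0.
Qed.
End MinimalDegree.

Lemma SL_transitive_degree (F : finFieldType) k (T : finType)
    (to : {action GLG F k &-> T}) (S : {set T}) :
  (2 < k)%N -> (2%:R : F) != 0 -> [transitive SLG F k, on S | to] -> (1 < #|S|)%N ->
  (#|F| ^ k.+1 - 1 <= #|S| * (#|F| - 1))%N.
Proof.
move=> k2 two0 trS S1; rewrite leqNgt; apply/negP=> S_lt.
exact: (small_action_False k2 trS S1 S_lt two0).
Qed.

(** * Scalars and indices of subgroups *)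

Lemma eigen_rows_scalar (F : fieldType) n (A : 'M[F]_n.+1) :
  (forall v : 'rV_n.+1, exists a, v *m A = a *: v) -> exists a, A = a%:M.
Proof.
move=> eigA; have AE i : exists a, forall j, A i j = a * (i == j)%:R.
  have [a /rowP aE] := eigA (delta_mx 0 i); exists a => j.
  by have := aE j; rewrite -rowE !mxE eqxx /= [j == i]eq_sym.
have A_diag i : A i i = A 0 0.
  have [->//|i0] := eqVneq i 0.
  have [c /rowP cE] := eigA (delta_mx 0 i + delta_mx 0 0).
  have [a aE] := AE i; have [b bE] := AE 0.
  have := cE i; have := cE 0; rewrite mulmxDl -!rowE !mxE !aE !bE !eqxx.
  rewrite (negPf i0) [0 == i]eq_sym (negPf i0) /= !(mulr0, mulr1, addr0, add0r).
  by move=> -> ->.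
exists (A 0 0); apply/matrixP=> i j; rewrite mxE; have [a aE] := AE i.
have [<-|ij] := eqVneq i j; first exact: A_diag.
by rewrite aE (negPf ij) mulr0.
Qed.

Section Scalars.
Variables (F : finFieldType) (k : nat).
Let n := k.+1.
Notation delta := (last_row F k).

Definition scGL (u : {unit F}) : GLG F k := mxGL (val u)%:M.

Lemma unit_neq0 (u : {unit F}) : val u != 0.
Proof. by rewrite -unitfE; apply: (valP u). Qed.

Lemma scGLE u : GLmx (scGL u) = (val u)%:M.
Proof. by rewrite mxGL_unit // unitmxE det_scalar unitrX //; apply: (valP u). Qed.

Lemma scGLM : {in setT &, {morph scGL : u v / (u * v)%g}}.
Proof. by move=> u v _ _; apply: GLmx_inj; rewrite GLmxM !scGLE -scalar_mxM. Qed.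

Canonical scGL_morphism := Morphism scGLM.

Lemma injm_scGL : 'injm scGL.
Proof.
apply/injmP=> u v _ _ /(congr1 (@GLmx F k)); rewrite !scGLE => E.
by apply: val_inj; have /matrixP/(_ 0 0) := E; rewrite !mxE.
Qed.

Lemma scGL_cent u : scGL u \in 'C([set: GLG F k]).
Proof.
apply/centP=> g _; apply: GLmx_inj.
by rewrite !GLmxM scGLE mul_scalar_mx mul_mx_scalar.
Qed.

Lemma scGL_SL u : (scGL u \in SLG F k) = (u ^+ n == 1)%g.
Proof.
rewrite mem_SLG scGLE det_scalar -val_eqE /=.
suff -> : val (u ^+ n)%g = val u ^+ n by [].
by elim: (n) => // m IH; rewrite expgS exprS /= -IH.
Qed.

Lemma scalar_scGL (g : GLG F k) a : GLmx g = a%:M -> exists u, g = scGL u.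
Proof.
move=> gE; have a0 : a != 0.
  apply: contraTneq (GLmx_unit g) => a0; rewrite gE a0.
  by rewrite unitmxE det_scalar expr0n unitr0.
have Ua : a \is a GRing.unit by rewrite unitfE.
by exists (FinRing.unit F Ua); apply: GLmx_inj; rewrite scGLE gE.
Qed.

Lemma eigen_scGL (g : GLG F k) :
  (forall v : 'rV_n, exists a, v *m GLmx g = a *: v) -> exists u, g = scGL u.
Proof. by case/eigen_rows_scalar=> a; apply: scalar_scGL. Qed.

(** Having all conjugates in P makes [x] preserve every line of rows, not only that of [delta]. *)
Lemma parabolic_core_scGL (x : GLG F k) : (0 < k)%N ->
  (forall g, g \in SLG F k -> (x ^ g)%g \in PG F k) -> exists u, x = scGL u.
Proof.
move=> k0 core_x; apply: eigen_scGL => v.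
have [->|v0] := eqVneq v 0; first by exists 0; rewrite mul0mx scaler0.
have [g Sg <-] := SL_trans_row k0 (last_row_neq0 F k) v0.
have /mem_PG[_ [a xa]] := core_x g^-1%g (groupVr Sg).
by exists a; rewrite -mulmxA -GLmxM conjgCV GLmxM mulmxA xa -scalemxAl.
Qed.

(** Commuting with [1 + c f] gives [(x c) f = c (f x)], so that [f x] is a multiple of [f]. *)
Lemma center_SL_scGL x : (1 < k)%N -> x \in 'Z(SLG F k) -> exists u, x = scGL u.
Proof.
move=> k1 /centerP[_ cx]; apply: eigen_scGL => f.
have [c [fc c0]] := @kernel_notin_line F _ _ f (0 : 'cV[F]_n) k1.
have {}c0 : c != 0 by apply: contraNneq c0 => ->; rewrite submx_refl.
have := congr1 (@GLmx F k) (cx _ (tv_SL fc)).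
rewrite !GLmxM tvE // mulmxDl mulmxDr mul1mx mulmx1 => /addrI E.
have /cV0Pn[i ci] := c0.
exists ((c i 0)^-1 * (GLmx x *m c) i 0); apply/rowP=> j.
have {}E : GLmx x *m c *m f = c *m (f *m GLmx x) by rewrite -mulmxA E mulmxA.
have /matrixP/(_ i j) := E.
move: (f *m GLmx x) (GLmx x *m c) => y z; rewrite !mxE !big_ord1 => yE.
by rewrite -mulrA yE mulKf.
Qed.

(** The entry [b] of an element of P, a linear character of P since [delta] is an eigenvector; the
    default 1 covers matrices whose corner entry is zero. *)
Definition corner (g : GLG F k) : {unit F} :=
  insubd (1%g : {unit F}) ((delta *m GLmx g *m delta^T) 0 0).

Lemma cornerE g : g \in PG F k -> delta *m GLmx g = val (corner g) *: delta.
Proof.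
case/mem_PG=> _ [a ga]; rewrite insubdK ga -?scalemxAl last_row_norm ?mxE ?mulr1 //.
rewrite -topredE /= unitfE; apply: contraNneq (last_row_neq0 F k) => a0.
by rewrite -[delta]mulmx1 -(GLmx_mulV g) mulmxA ga a0 scale0r mul0mx.
Qed.

Lemma scale_last_row_inj : injective (fun a => a *: delta).
Proof.
move=> a b /eqP; rewrite -subr_eq0 -scalerBl scaler_eq0 subr_eq0.
by rewrite (negPf (last_row_neq0 F k)) orbF => /eqP.
Qed.

Lemma cornerM : {in PG F k &, {morph corner : g h / (g * h)%g}}.
Proof.
move=> g h Pg Ph; apply/val_inj/scale_last_row_inj.
rewrite /= -cornerE ?groupM // GLmxM mulmxA cornerE // -scalemxAl cornerE //.
by rewrite scalerA.
Qed.

Canonical corner_morphism := Morphism cornerM.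

Lemma im_corner : (0 < k)%N -> corner @* PG F k = [set: {unit F}].
Proof.
move=> k0; apply/setP=> u; rewrite inE.
have [|g Sg ga] := SL_trans_row k0 (last_row_neq0 F k) (y := val u *: delta).
  by rewrite scaler_eq0 negb_or last_row_neq0 unit_neq0.
have Pg : g \in PG F k by apply/mem_PG; split=> //; exists (val u).
apply/morphimP; exists g => //.
by apply/val_inj/scale_last_row_inj; rewrite -ga -cornerE.
Qed.

Lemma corner_scGL u : scGL u \in PG F k -> corner (scGL u) = u.
Proof.
move=> Pu; apply/val_inj/scale_last_row_inj.
by rewrite -cornerE // scGLE mul_mx_scalar.
Qed.

End Scalars.

Local Close Scope ring_scope.

(** * Indices in SL_n and degrees of faithful collections *)

Section Indices.
Variables (F : finFieldType) (k : nat).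
Let n := k.+1.
Let q := #|F|.
Hypothesis k_gt2 : (2 < k)%N.
Hypothesis odd_q : odd q.

Let k_gt1 : (1 < k)%N. Proof. exact: ltnW. Qed.
Let k_gt0 : (0 < k)%N. Proof. exact: ltnW. Qed.
Let q1_gt0 : (0 < q - 1)%N. Proof. by rewrite subn_gt0 card_finRing_gt1. Qed.

Let SLn := SLG F k.
Let Pn := PG F k.

Lemma SL_index_bound (H : {group GLG F k}) : H \subset SLn -> H :!=: SLn ->
  (q ^ n - 1 <= #|SLn : H| * (q - 1))%N.
Proof.
move=> sH neH; apply: (SL_transitive_degree k_gt2 (two_neq0_odd_card odd_q)
  (transRs_rcosets H SLn)).
by rewrite indexg_gt1; apply: contra neH => sHG; rewrite eqEsubset sH.
Qed.

(** The [pi]-part of the group of all scalars of GL_n. Its inclusion in SL_n is where very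
    divisibility enters. *)
Definition scalars (pi : nat_pred) : {group GLG F k} :=
  (@scGL F k @* 'O_pi([set: {unit F}]))%G.

Lemma abelian_unit (G : {group {unit F}}) : abelian G.
Proof. exact/cyclic_abelian/field_unit_group_cyclic. Qed.

Lemma card_pcore_unit pi : #|'O_pi([set: {unit F}])| = ((q - 1)`_pi)%N.
Proof.
rewrite (card_Hall (nilpotent_pcore_Hall pi (abelian_nil (abelian_unit _)))).
by rewrite card_finField_unit subn1.
Qed.

Lemma card_scalars pi : #|scalars pi| = ((q - 1)`_pi)%N.
Proof. by rewrite card_injm ?injm_scGL ?subsetT // card_pcore_unit. Qed.

Lemma scalarsP pi x : reflect (exists2 u, u \in 'O_pi([set: {unit F}]) & x = scGL k u)
  (x \in scalars pi).
Proof.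
apply: (iffP morphimP) => [[u _ Ou ->]|[u Ou ->]]; first by exists u.
by exists u; rewrite ?inE.
Qed.

Lemma scalars_cyclic pi : cyclic (scalars pi).
Proof. exact/morphim_cyclic/field_unit_group_cyclic. Qed.

Lemma scalars_cent pi (H : {group GLG F k}) : scalars pi \subset 'C(H).
Proof.
apply/subsetP=> _ /scalarsP[u _ ->]; apply: (subsetP (centS (subsetT H))).
exact: scGL_cent.
Qed.

Lemma scalars_pgroup pi : pi.-group (scalars pi).
Proof. by rewrite /pgroup card_scalars part_pnat. Qed.

Lemma mem_scalars (pi : nat_pred) x : x \in scalars predT -> pi.-elt x ->
  x \in scalars pi.
Proof.
case/scalarsP=> u _ -> pu; apply/scalarsP; exists u => //.
have nO := nilpotent_pcore_Hall pi (abelian_nil (abelian_unit [set: {unit F}])).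
rewrite (mem_normal_Hall nO) ?pcore_normal ?inE //.
by move: pu; rewrite /p_elt (order_injm (injm_scGL F k)) ?inE.
Qed.

Lemma scGL_scalars u : scGL k u \in scalars predT.
Proof.
apply/scalarsP; exists u => //; rewrite pcore_pgroup_id ?inE //.
by rewrite /pgroup; apply/pnatP.
Qed.

Hypothesis n_div : very_divisible n q.

(** The order of [u] divides the [pi]-part of [q - 1], which divides [n], prime by prime, because
    [n] is very divisible. *)
Lemma scalars_sub_SL (pi : nat_pred) : {subset pi <= primes (gcdn n (q - 1))} ->
  scalars pi \subset SLn.
Proof.
move=> sub_pi; apply/subsetP=> _ /scalarsP[u Ou ->]; rewrite scGL_SL -order_dvdn.
apply: dvdn_trans (order_dvdG Ou) _; rewrite card_pcore_unit.
apply/dvdn_partP=> [|p]; first exact: part_gt0.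
rewrite pi_of_part // inE /= => /andP[_ pi_p].
have sub_p : {subset (p : nat_pred) <= pi} by move=> r; rewrite inE => /eqP->.
by rewrite partn_part // p_part; apply: n_div; apply: sub_pi.
Qed.

(* Multiplying H by the J-part Z of the scalars divides its index by #|Z|, and
   H Z stays proper because SL_n is perfect and Z is central. *)
Lemma SL_index_bound_avoiding (H : {group GLG F k}) (J : seq nat) :
  H \subset SLn -> H :!=: SLn -> uniq J -> {subset J <= primes (gcdn n (q - 1))} ->
  {in J, forall p : nat, H :&: scalars p = 1} ->
  ((q ^ n - 1) * \prod_(p <- J) p ^ logn p (q - 1) <= #|SLn : H| * (q - 1))%N.
Proof.
move=> sH neH uJ sJ tiH; pose pi := [pred p in J] : nat_pred; pose Z := scalars pi.
have sZ : Z \subset SLn by apply: scalars_sub_SL.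
have tiHZ : H :&: Z = 1.
  apply/eqP/negPn/negP=> ntHZ; have := ntHZ.
  rewrite -(cardG_gt1 (H :&: Z)) => /pdivP[p p_pr /Cauchy[//|x /setIP[Hx Zx] ox]].
  have Jp : p \in J.
    by have := mem_p_elt (scalars_pgroup pi) Zx; rewrite /p_elt ox pnatE.
  have : x \in H :&: scalars p.
    rewrite inE Hx; apply: mem_scalars; last by rewrite /p_elt ox pnat_id.
    by case/scalarsP: Zx => u _ ->; apply: scGL_scalars.
  by rewrite tiH // => /set1P x1; move: p_pr; rewrite -ox x1 order1.
have cardHZ : #|H * Z| = (#|H| * #|Z|)%N by rewrite TI_cardMg.
have HZgroup : H <*> Z = H * Z by rewrite cent_joinEr // scalars_cent.
have neHZ : H <*> Z != SLn.
  have perfS : SLn^`(1) = SLn := SL_perfect F k_gt1.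
  apply: contra neH => /eqP HZE; rewrite eqEsubset sH /=.
  have := derived_sub_central_mul (scalars_cent pi H) (cyclic_abelian (scalars_cyclic pi)).
  by rewrite -HZgroup HZE perfS.
have sHZ : H <*> Z \subset SLn by rewrite join_subG sH.
have := SL_index_bound sHZ neHZ.
rewrite -(Lagrange_index sHZ (joing_subl H Z)).
have -> : #|H <*> Z : H| = (\prod_(p <- J) p ^ logn p (q - 1))%N.
  rewrite -divgS ?joing_subl //= HZgroup cardHZ mulKn // card_scalars partn_seq //.
  by move=> p /sJ; rewrite !mem_primes gcdn_gt0 dvdn_gcd q1_gt0 => /and3P[-> _ /andP[_ ->]].
by rewrite mulnAC => le; apply: leq_mul.
Qed.

Lemma scalars_prime_sub_SL (p : nat) : p \in primes (gcdn n (q - 1)) ->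
  scalars p \subset SLn.
Proof. by move=> p_g; apply: scalars_sub_SL => r; rewrite inE => /eqP->. Qed.

Lemma scalars_cycle_eq x y : x \in scalars predT -> y \in scalars predT ->
  #[x] = #[y] -> <[x]> = <[y]>.
Proof.
move=> Zx Zy oxy; apply/eqP.
by rewrite (eq_subG_cyclic (scalars_cyclic predT)) ?cycle_subG // -!orderE oxy.
Qed.

Lemma scalars_pred_sub pi x : x \in scalars pi -> x \in scalars predT.
Proof. by case/scalarsP=> u _ ->; apply: scGL_scalars. Qed.

(** Otherwise every member meets the cyclic group [scalars p] nontrivially and contains its only
    subgroup of order [p], which is central and therefore in the core. *)
Lemma faithful_collection_avoids t (p : nat) : faithful_collection SLn t ->
  p \in primes (gcdn n (q - 1)) -> exists2 H, H \in t & H :&: scalars p = 1.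
Proof.
case/faithful_collectionP=> _ faith_t p_g.
have := p_g; rewrite mem_primes dvdn_gcd => /and3P[p_pr _ /andP[_ p_q1]].
have /(Cauchy p_pr)[z Zz oz] : (p %| #|scalars p|)%N.
  rewrite card_scalars p_part.
  by rewrite -{1}[p]expn1 dvdn_exp2l // logn_gt0 mem_primes p_pr q1_gt0.
have Sz := subsetP (scalars_prime_sub_SL p_g) _ Zz.
have [/hasP[H tH /eqP]|/hasPn nt] := boolP (has (fun H : {group _} => H :&: scalars p == 1) t).
  by exists H.
suff z1 : z = 1 by move: p_pr; rewrite -oz z1 order1.
apply: faith_t => // H g tH Sg.
have -> : z ^ g = z.
  by apply/conjg_fixP/commgP/(centsP (scalars_cent p SLn)).
have pHZ : p.-group (H :&: scalars p) := pgroupS (subsetIr _ _) (scalars_pgroup p).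
have [_ /(Cauchy p_pr)[x /setIP[Hx Zx] ox] _] := pgroup_pdiv pHZ (nt H tH).
have := scalars_cycle_eq (scalars_pred_sub Zx) (scalars_pred_sub Zz) (etrans ox (esym oz)).
move/setP/(_ z).
by rewrite cycle_id => /cycleP[i ->]; apply: groupX.
Qed.

(** Let [J H] be the primes that [H] avoids. Every prime occurs in some [J H], and the product bound
    for [H] dominates the sum over [J H]; a member with empty [J H] contributes zero to that sum. *)
Lemma faithful_collection_bound t : faithful_collection SLn t ->
  ((q ^ n - 1) * \sum_(p <- primes (gcdn n (q - 1))) p ^ logn p (q - 1)
   <= collection_degree SLn t * (q - 1))%N.
Proof.
move=> faith_t; have [sub_t _] := faithful_collectionP _ _ faith_t.
set ps := primes _; pose a (p : nat) := (p ^ logn p (q - 1))%N.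
pose J (H : {group GLG F k}) := [seq p : nat <- ps | H :&: scalars p == 1].
have a_ge2 p : p \in ps -> (1 < a p)%N.
  rewrite mem_primes dvdn_gcd => /and3P[p_pr _ /andP[_ p_q1]].
  rewrite /a -{1}(expn0 p) ltn_exp2l ?prime_gt1 //.
  by rewrite logn_gt0 mem_primes p_pr q1_gt0.
have sum_J : (\sum_(p <- ps) a p <= \sum_(H <- t) \sum_(p <- J H) a p)%N.
  under [X in (_ <= X)%N]eq_bigr => H _ do rewrite big_filter.
  rewrite (exchange_big_dep xpredT) //= big_seq [X in (_ <= X)%N]big_seq.
  apply: leq_sum => p p_ps; have [H tH HZ] := faithful_collection_avoids faith_t p_ps.
  by rewrite (big_rem H tH) HZ eqxx leq_addr.
apply: leq_trans (leq_mul (leqnn _) sum_J) _.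
rewrite /collection_degree big_distrl big_distrr /= big_seq [X in (_ <= X)%N]big_seq.
apply: leq_sum => H tH; have [->|J0] := eqVneq (J H) [::]; first by rewrite big_nil muln0.
have sJ : {subset J H <= ps} by move=> p; rewrite mem_filter => /andP[].
apply: leq_trans (_ : _ <= (q ^ n - 1) * \prod_(p <- J H) a p)%N _.
  rewrite leq_mul2l; apply/orP; right.
  rewrite -(big_map a xpredT id) -[X in (_ <= X)%N](big_map a xpredT id).
  apply: leq_sum_prod; first by case: (J H) J0.
  by apply/allP=> _ /mapP[p /sJ/a_ge2 a2 ->].
apply: SL_index_bound_avoiding; rewrite ?filter_uniq ?primes_uniq //.
- exact: sub_t.
(* SL_n itself contains every [scalars p], so a subgroup avoiding some prime is proper. *)
- have [p Jp] : exists p, p \in J H.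
    by case: (J H) J0 => // p s _; exists p; rewrite inE eqxx.
  apply/eqP=> HE; move: Jp; rewrite mem_filter HE => /andP[/eqP tiZ p_ps].
  have := a_ge2 p p_ps; rewrite /a -p_part -card_scalars.
  by rewrite -(setIidPr (scalars_prime_sub_SL p_ps)) tiZ cards1.
by move=> p; rewrite mem_filter => /andP[/eqP].
Qed.

(** The core consists of scalars since it lies in all conjugates of P; a nontrivial one has a power
    of prime order [p], and [p] divides [n] and [q - 1]. An empty list of primes is allowed, for the
    case [g = 1]. *)
Lemma parabolic_collection_faithful t : t != [::] ->
  {in t, forall K : {group GLG F k}, K \subset Pn} ->
  {in primes (gcdn n (q - 1)), forall p, exists2 K, K \in t &
     forall x, x \in K -> x \in scalars predT -> #[x] <> p} ->
  faithful_collection SLn t.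
Proof.
move=> t0 sub_t avoid_t; have sPS : Pn \subset SLn := PG_sub_SLG F k.
apply/faithful_collectionP; split=> [K /sub_t sKP|x Sx core_x].
  exact: subset_trans sPS.
have [K0 tK0] : exists K, K \in t.
  by case: (t) t0 => // K s _; exists K; rewrite inE eqxx.
have [u xE] : exists u, x = scGL k u.
  apply: parabolic_core_scGL => // g Sg.
  by apply: (subsetP (sub_t K0 tK0)); apply: core_x.
have Zx : x \in scalars predT by rewrite xE scGL_scalars.
apply/eqP/negPn/negP=> x1; move: x1; rewrite -order_eq1 => ox1.
have /pdivP[p p_pr /(Cauchy p_pr)[y xy oy]] : (1 < #[x])%N.
  by rewrite ltn_neqAle eq_sym ox1 order_gt0.
have Zy : y \in scalars predT by apply: subsetP xy; rewrite cycle_subG.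
have Sy : y \in SLn by apply: subsetP xy; rewrite cycle_subG.
have p_g : p \in primes (gcdn n (q - 1)).
  rewrite mem_primes p_pr gcdn_gt0 /= dvdn_gcd -oy; apply/andP; split.
    case/scalarsP: Zy => v _ yE; move: Sy; rewrite yE scGL_SL order_dvdn => /eqP vn.
    by rewrite -morphX ?inE // vn morph1.
  apply: dvdn_trans (order_dvdG Zy) _; rewrite card_scalars; exact: dvdn_part.
have [K tK avoidK] := avoid_t p p_g.
apply: (avoidK y) => //; apply: subsetP xy; rewrite cycle_subG.
by rewrite -[x]conjg1 core_x.
Qed.

(** An explicit candidate for the largest subgroup of P avoiding the scalars of order [p]: the
    corner of a scalar is that scalar itself. *)
Definition corner_p'_part (p : nat) : {group GLG F k} :=
  (@corner F k @*^-1 'O_(p^'%N)([set: {unit F}]))%G.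

Lemma corner_p'_part_sub p : corner_p'_part p \subset Pn.
Proof. exact: subsetIl. Qed.

Lemma index_corner_p'_part (p : nat) : #|Pn : corner_p'_part p| = (p ^ logn p (q - 1))%N.
Proof.
have PnE : (Pn : {set _}) = @corner F k @*^-1 [set: {unit F}].
  by rewrite -(im_corner F k_gt0) morphimGK ?ker_sub_pre //; apply: subsetIl.
rewrite PnE index_morphpre ?im_corner // -divgS ?subsetT // card_pcore_unit.
rewrite card_finField_unit -subn1 -p_part -{1}(partnC p q1_gt0) mulnK //.
Qed.

Lemma corner_p'_part_avoids (p : nat) x : prime p -> x \in corner_p'_part p ->
  x \in scalars predT -> #[x] <> p.
Proof.
move=> p_pr Lx /scalarsP[u _ xE] ox.
have [Px Ou] := morphpreP Lx; rewrite xE in Px Ou.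
rewrite /= corner_scGL // in Ou.
have := mem_p_elt (pcore_pgroup _ _) Ou; rewrite /p_elt.
by rewrite -(order_injm (injm_scGL F k)) ?inE //= -xE ox pnatE // !inE eqxx.
Qed.

Lemma central_scalars (Z : {group GLG F k}) : Z \subset 'Z(SLn) -> Z \subset scalars predT.
Proof.
move=> sZ; apply/subsetP=> x /(subsetP sZ)/(center_SL_scGL k_gt1)[u ->].
exact: scGL_scalars.
Qed.

(** [corner_p'_part p] meets [Z] trivially, so [H] is at least as large. *)
Lemma index_biggest_avoiding (p : nat) (Z H : {group GLG F k}) : prime p ->
  Z \subset 'Z(SLn) -> #|Z| = p -> biggest_avoiding Pn Z H ->
  (#|Pn : H| <= p ^ logn p (q - 1))%N.
Proof.
move=> p_pr sZ oZ [sHP _ maxH]; rewrite -index_corner_p'_part.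
have : (#|corner_p'_part p| <= #|H|)%N.
  apply: maxH; first exact: corner_p'_part_sub.
  apply/eqP; rewrite eqEsubset sub1G andbT; apply/subsetP=> x /setIP[Lx Zx].
  have := order_dvdG Zx; rewrite oZ; case/(dvdn_pfactor _ 1 p_pr) => -[|[|//]] _ ox.
    by rewrite inE -order_eq1 ox.
  have sc_x := subsetP (central_scalars sZ) x Zx.
  by case: (corner_p'_part_avoids p_pr Lx sc_x); rewrite ox expn1.
have := Lagrange (corner_p'_part_sub p); rewrite -(Lagrange sHP) => E le.
by rewrite -(leq_pmul2l (cardG_gt0 (corner_p'_part p))) E leq_mul2r le orbT.
Qed.

(** The scalars form a cyclic group, so a scalar of order [p] generates [Z]. *)
Lemma biggest_avoiding_no_central (p : nat) (Z H : {group GLG F k}) x : prime p ->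
  Z \subset 'Z(SLn) -> #|Z| = p -> biggest_avoiding Pn Z H ->
  x \in H -> x \in scalars predT -> #[x] <> p.
Proof.
move=> p_pr sZ oZ [_ tiHZ _] Hx Zx ox.
have /eqP xZ : <[x]> == Z :> {set _}.
  rewrite (eq_subG_cyclic (scalars_cyclic predT)) ?cycle_subG ?central_scalars //.
  by rewrite -orderE ox oZ.
have : x \in H :&: Z by rewrite inE Hx -xZ cycle_id.
by rewrite tiHZ => /set1P x1; move: p_pr; rewrite -ox x1 order1.
Qed.

(** The indices bound the degree from above by the value that [faithful_collection_bound] gives from
    below. The conditions on [H p] suit both [corner_p'_part] and arbitrary largest subgroups. *)
Lemma prime_collection_minimal (H : nat -> {group GLG F k}) :
  primes (gcdn n (q - 1)) != [::] ->
  {in primes (gcdn n (q - 1)), forall p, [/\ H p \subset Pn,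
     forall x, x \in H p -> x \in scalars predT -> #[x] <> p
     & #|Pn : H p| <= p ^ logn p (q - 1)]%N} ->
  let t := [seq H p | p <- primes (gcdn n (q - 1))] in
  minimal_faithful SLn t /\
  (collection_degree SLn t * (q - 1) =
   (q ^ n - 1) * \sum_(p <- primes (gcdn n (q - 1))) p ^ logn p (q - 1))%N.
Proof.
move=> ps0 HP t; set B := (X in _ /\ _ = X).
have faith_t : faithful_collection SLn t.
  apply: parabolic_collection_faithful.
  - by rewrite /t; case: (primes _) ps0.
  - by move=> _ /mapP[p /HP[sHP _ _] ->].
  by move=> p p_g; have [_ avoid _] := HP p p_g; exists (H p) => //; apply: map_f.
have le_t : (collection_degree SLn t * (q - 1) <= B)%N.
  rewrite /collection_degree /t big_map /B big_distrl big_distrr /= big_seq.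
  rewrite [X in (_ <= X)%N]big_seq; apply: leq_sum => p /HP[sHP _ le_p].
  rewrite -(Lagrange_index (PG_sub_SLG F k) sHP) mulnAC index_parabolic //.
  by rewrite leq_mul2l le_p orbT.
split; last by apply/eqP; rewrite eqn_leq le_t faithful_collection_bound.
split=> // u faith_u; rewrite -(leq_pmul2r q1_gt0).
exact: leq_trans le_t (faithful_collection_bound faith_u).
Qed.

(** A faithful collection has a proper member, as the core would otherwise be SL_n, and a proper
    subgroup has index at least that of P. *)
Lemma parabolic_minimal : primes (gcdn n (q - 1)) = [::] ->
  minimal_faithful SLn [:: Pn].
Proof.
move=> ps0; split.
  apply: parabolic_collection_faithful => //; first by move=> K; rewrite inE => /eqP->.
  by rewrite ps0.
move=> t /faithful_collectionP[sub_t faith_t].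
rewrite {1}/collection_degree big_seq1.
have [/hasP[K tK neK]|/hasPn allS] := boolP (has (fun K : {group GLG F k} => K :!=: SLn) t).
  apply: (@leq_trans #|SLn : K|); last by rewrite /collection_degree (big_rem K tK) leq_addr.
  rewrite -(leq_pmul2r q1_gt0) index_parabolic //.
  by apply: SL_index_bound => //; apply: sub_t.
have [x x0] := @notin_rowspace F 1 k 0%R k_gt1.
have cr1 y : @col_root F k y = 1.
  apply: faith_t => [|K g tK Sg]; first exact: col_root_SL.
  have := allS K tK; rewrite negbK => /eqP->.
  by rewrite groupJ ?col_root_SL.
case/negP: x0; suff -> : x = 0%R by rewrite trmx0 sub0mx.
by apply: (@col_root_inj F k); rewrite !cr1.
Qed.
End Indices.

Local Open Scope nat_scope.

Theorem theorem2p3 (F : finFieldType) (q n : nat) (hF : #|F| = q)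
    (hq : odd q) (hn : 4 <= n) (hdiv : very_divisible n q) :
  (gcdn n (q - 1) = 1 ->
     [/\ minimal_faithful (SL_group n F) [:: parabolic_group n F],
         perm_degree (SL_group n F) = #|SL n F| %/ #|parabolic n F|
       & #|SL n F| %/ #|parabolic n F| = (q ^ n - 1) %/ (q - 1)])
  /\
  (1 < gcdn n (q - 1) ->
     (forall Z H : nat -> {group {'GL_n[F]}},
        (forall p, p \in primes (gcdn n (q - 1)) ->
           [/\ Z p \subset 'Z(SL n F), #|Z p| = p
             & biggest_avoiding (parabolic_group n F) (Z p) (H p)]) ->
        minimal_faithful (SL_group n F)
          [seq H p | p <- primes (gcdn n (q - 1))])
     /\ perm_degree (SL_group n F)
        = (q ^ n - 1) %/ (q - 1)
          * \sum_(p <- primes (gcdn n (q - 1))) p ^ logn p (q - 1)).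
Proof.
subst q; case: n hn hdiv => [//|k] k_gt2 hdiv; set q := #|F|.
have q1_gt0 : 0 < q - 1 by rewrite subn_gt0 card_finRing_gt1.
have indexP : #|SLG F k : PG F k| * (q - 1) = q ^ k.+1 - 1.
  by apply: index_parabolic; apply: ltnW; apply: ltnW.
have divP : #|SL k.+1 F| %/ #|parabolic k.+1 F| = #|SLG F k : PG F k|.
  exact: divgS (PG_sub_SLG F k).
have indexPE : #|SLG F k : PG F k| = (q ^ k.+1 - 1) %/ (q - 1) by rewrite -indexP mulnK.
have prime_ps p : p \in primes (gcdn k.+1 (q - 1)) -> prime p.
  by rewrite mem_primes => /andP[].
split=> [g1|g_gt1].
  have minP : minimal_faithful (SLG F k) [:: PG F k].
    by apply: (parabolic_minimal k_gt2 hq); rewrite -/q g1.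
  split; [exact: minP | rewrite divP | by rewrite divP].
  by rewrite (perm_degree_minimal_faithful minP) /collection_degree big_seq1.
have ps0 : primes (gcdn k.+1 (q - 1)) != [::].
  have /pdivP[p p_pr p_dv] := g_gt1.
  have : p \in primes (gcdn k.+1 (q - 1)) by rewrite mem_primes p_pr p_dv (ltnW g_gt1).
  by case: (primes _).
split=> [Z H ZH|].
  apply: (proj1 (prime_collection_minimal k_gt2 hq hdiv ps0 _)) => p p_g.
  have [sZ oZ bigH] := ZH p p_g; have p_pr := prime_ps p p_g.
  split; first by case: bigH.
    by move=> x; apply: (biggest_avoiding_no_central k_gt2 p_pr sZ oZ bigH).
  exact: (index_biggest_avoiding k_gt2 p_pr sZ oZ bigH).
(* The degree is claimed without any given [H], so an explicit collection is needed. *)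
have [|min_t degE] := prime_collection_minimal k_gt2 hq hdiv (H := corner_p'_part F k) ps0.
  move=> p p_g; split; first exact: corner_p'_part_sub.
    by move=> x; apply: corner_p'_part_avoids; apply: prime_ps.
  by rewrite index_corner_p'_part.
rewrite (perm_degree_minimal_faithful min_t) -indexPE.
apply/eqP; rewrite -(eqn_pmul2r q1_gt0) degE -indexP; apply/eqP.
by rewrite mulnAC.
Qed.
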